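(* Let $\mathbf{U}$ be a smooth connected unipotent group over an infinite field $k$ equipped with a positive action of $\mathbb{G}_m$ and let $\mathbb{F}$ be another field. Let $I \subset \mathbb{F}[\mathbf{U}(k)]$ be a left ideal that is stable under $\mathbb{G}_m$ and not contained in the augmentation ideal. Then $I = \mathbb{F}[\mathbf{U}(k)]$.
   Context: An action of $\mathbb{G}_m$ on $\mathbf{U}$ means an algebraic action (defined over $k$) by group automorphisms; for $t \in \mathbb{G}_m(k)=k^{\times}$ and $g \in \mathbf{U}(k)$ write ${}^{t}g$ for the action of $t$ on $g$. If $\mathbb{G}_m$ acts algebraically and linearly on a $k$-vector space $V$, then $V$ is a direct sum of weight spaces $V_d$ ($d\in\mathbb{Z}$), where $t\in k^\times$ acts on $V_d$ by $t\cdot v = t^d v$; the integers $d$ with $V_d\neq 0$ are the weights. The action of $\mathbb{G}_m$ on $\mathbf{U}$ is called positive if all weights of the induced action on the Lie algebra $\mathrm{Lie}(\mathbf{U})$ are positive. $\mathbb{F}[\mathbf{U}(k)]$ is the group ring of the abstract group $\mathbf{U}(k)$, and the augmentation ideal is the kernel of the augmentation $\epsilon\colon \mathbb{F}[\mathbf{U}(k)]\to\mathbb{F}$, $\sum c_i[g_i]\mapsto \sum c_i$. That $I$ is stable under $\mathbb{G}_m$ means that for all $t\in k^\times$ and all $\sum_i c_i[g_i]\in I$ one has $\sum_i c_i[{}^{t}g_i]\in I$. *)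

(* Defs.v *)
From HB Require Import structures.
From mathcomp Require Import all_boot all_order all_algebra.
From mathcomp Require Import finmap boolp classical_sets cardinality.
From mathcomp Require Import monalg.

Set Implicit Arguments.
Unset Strict Implicit.
Unset Printing Implicit Defensive.

Import GRing.Theory.
Local Open Scope ring_scope.

(* An affine group scheme Spec A over k, as a representable group functor:    *)
(* a group law on Hom_k-alg(A, R), functorial in the k-algebra R. Members of  *)
(* comAlgType are nonzero rings; nothing is lost, since the zero ring has     *)
(* exactly one point.                                                         *)
Record groupScheme (k : fieldType) := GroupScheme {
  coord : comAlgType k;
  gs_one : forall R : comAlgType k, {lrmorphism coord -> R};
  gs_inv : forall R : comAlgType k,
    {lrmorphism coord -> R} -> {lrmorphism coord -> R};
  gs_mul : forall R : comAlgType k,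
    {lrmorphism coord -> R} -> {lrmorphism coord -> R} ->
    {lrmorphism coord -> R};
  gs_mulA : forall R, associative (@gs_mul R);
  gs_mul1 : forall R, left_id (gs_one R) (@gs_mul R);
  gs_mulr1 : forall R, right_id (gs_one R) (@gs_mul R);
  gs_mulV : forall R, left_inverse (gs_one R) (@gs_inv R) (@gs_mul R);
  gs_mulrV : forall R, right_inverse (gs_one R) (@gs_inv R) (@gs_mul R);
  gs_mul_nat : forall (R S : comAlgType k) (phi : {lrmorphism R -> S})
      (g h : {lrmorphism coord -> R}),
    gs_mul (phi \o g : {lrmorphism coord -> S}) (phi \o h) = phi \o gs_mul g h
      :> {lrmorphism coord -> S}
}.

Definition points (k : fieldType) (U : groupScheme k) (R : comAlgType k) : Type :=
  {lrmorphism coord U -> R}.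

Section Points.
Variables (k : fieldType) (U : groupScheme k).

HB.instance Definition _ (R : comAlgType k) := gen_eqMixin (points U R).
HB.instance Definition _ (R : comAlgType k) := gen_choiceMixin (points U R).
HB.instance Definition _ (R : comAlgType k) := isGroup.Build (points U R)
  (@gs_mulA k U R) (@gs_mul1 k U R) (@gs_mulr1 k U R) (@gs_mulV k U R)
  (@gs_mulrV k U R).

Definition pt_fun (R : comAlgType k) (g : points U R) : {lrmorphism coord U -> R}
  := g.

Definition pt_map (R S : comAlgType k) (phi : {lrmorphism R -> S})
  (g : points U R) : points U S := phi \o pt_fun g.

End Points.

Coercion pt_fun : points >-> GRing.LRMorphism.type.

Section Geometry.
Variable k : fieldType.
Implicit Types (A : comAlgType k) (U : groupScheme k).

Definition generates A (X : set A) : Prop :=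
  forall S : {pred A}, GRing.subalg_closed S -> (forall x, X x -> x \in S) ->
  forall a, a \in S.

Definition finite_type A : Prop :=
  exists2 X : set A, finite_set X & generates X.

(* Morphisms to Spec A extend along square-zero thickenings. *)
Definition formally_smooth A : Prop :=
  forall (B C : comAlgType k) (p : {lrmorphism B -> C}),
    (forall c, exists b, p b = c) ->
    (forall x y, p x = 0 -> p y = 0 -> x * y = 0) ->
  forall f : {lrmorphism A -> C}, exists g : {lrmorphism A -> B}, p \o g =1 f.

(* Over a field, finite type is the same as finite presentation. *)
Definition smooth U : Prop :=
  finite_type (coord U) /\ formally_smooth (coord U).

Definition Spec A : Type := prime_idealr A.

Definition zero_locus A (X : set A) : set (Spec A) :=
  [set P | forall x, X x -> x \in (P : prime_idealr A)].

(* Nonemptiness of Spec is automatic: the identity is a rational point. *)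
Definition connected U : Prop :=
  forall X Y : set (coord U),
    (zero_locus X `|` zero_locus Y = [set: Spec (coord U)])%classic ->
    (zero_locus X `&` zero_locus Y = set0)%classic ->
  (zero_locus X = set0 \/ zero_locus Y = set0)%classic.

(* U is isomorphic to a closed subgroup of the group of upper unitriangular   *)
(* n x n matrices. A homomorphism from U to that group is a matrix M of       *)
(* functions on U; it is a closed immersion iff the entries of M generate the *)
(* coordinate ring.                                                           *)
Definition unipotent U : Prop :=
  exists (n : nat) (M : 'M[coord U]_n),
    [/\ forall i j : 'I_n, (j <= i)%N -> M i j = (i == j)%:R,
        forall (R : comAlgType k) (g h : points U R),
          map_mx (g * h : points U R)%g M = map_mx g M *m map_mx h M
      & generates [set a | exists i j, a = M i j]].

End Geometry.

(* The points of G_m. *)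
Record gm (R : comNzRingType) := Gm {
  gm_val :> R;
  gm_inv : R;
  gm_valV : gm_val * gm_inv = 1
}.

Definition gm1 (R : comNzRingType) : gm R := Gm (mulr1 (1 : R)).

Lemma gm_mul_subproof (R : comNzRingType) (s t : gm R) :
  (gm_val s * gm_val t) * (gm_inv s * gm_inv t) = 1.
Proof. by rewrite mulrACA !gm_valV mulr1. Qed.

Definition gm_mul (R : comNzRingType) (s t : gm R) : gm R :=
  Gm (gm_mul_subproof s t).

Lemma gm_map_subproof (R S : comNzRingType) (phi : {rmorphism R -> S})
  (t : gm R) : phi (gm_val t) * phi (gm_inv t) = 1.
Proof. by rewrite -rmorphM gm_valV rmorph1. Qed.

Definition gm_map (R S : comNzRingType) (phi : {rmorphism R -> S}) (t : gm R) :
  gm S := Gm (gm_map_subproof phi t).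

(* An algebraic action of G_m on U by group automorphisms. *)
Record gmAction (k : fieldType) (U : groupScheme k) := GmAction {
  gma_act : forall R : comAlgType k, gm R -> points U R -> points U R;
  gma_act1 : forall (R : comAlgType k) (g : points U R),
    gma_act (gm1 R) g = g;
  gma_actM : forall (R : comAlgType k) (s t : gm R) (g : points U R),
    gma_act (gm_mul s t) g = gma_act s (gma_act t g);
  gma_mul : forall (R : comAlgType k) (t : gm R) (g h : points U R),
    gma_act t (g * h)%g = (gma_act t g * gma_act t h)%g;
  gma_nat : forall (R S : comAlgType k) (phi : {lrmorphism R -> S})
      (t : gm R) (g : points U R),
    gma_act (gm_map phi t) (pt_map phi g) = pt_map phi (gma_act t g)
}.

Section Action.
Variables (k : fieldType) (U : groupScheme k) (alpha : gmAction U).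

Definition act_pt (t : gm k) (g : points U k^o) : points U k^o :=
  gma_act alpha (t : gm k^o) g.

(* The endomorphism of the coordinate ring corresponding to the automorphism  *)
(* of U defined by t : by Yoneda, t applied to the tautological point.        *)
Definition comorphism (t : gm k) : {lrmorphism coord U -> coord U} :=
  gma_act alpha (gm_map (GRing.in_alg (coord U)) t)
    (idfun : {lrmorphism coord U -> coord U}).

(* Lie(U) is the tangent space at the identity e, i.e., the space of          *)
(* k-linear derivations of the coordinate ring into k regarded as a module    *)
(* through evaluation at e.                                                   *)
Definition Lie : set {linear coord U -> k^o} :=
  [set D | let e : points U k^o := 1%g in
           forall a b, D (a * b) = e a * D b + e b * D a].

Definition lie_act (t : gm k) (D : {linear coord U -> k^o}) :
  {linear coord U -> k^o} := D \o comorphism t.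

(* As k is meant to be infinite, the weight spaces are detected by k-points. *)
Definition weight (d : int) : Prop :=
  exists D, [/\ Lie D, exists a, D a != 0
    & forall (t : gm k) (a : coord U), lie_act t D a = (gm_val t ^ d) *: D a].

Definition positive : Prop := forall d : int, weight d -> 0 < d.

End Action.

(* {malg F[G]} is the space of finitely supported functions G -> F, and       *)
(* << c *g g >> is c[g]. The ring structure of monalg requires a monoid       *)
(* without nontrivial units, whence this copy.                                *)
Definition groupRing (F : fieldType) (G : groupType) : Type := {malg F[G]}.

Section GroupRing.
Variables (F : fieldType) (G : groupType).
Implicit Types (x y z : {malg F[G]}) (g h : G).

Definition grone : {malg F[G]} := << 1 *g 1%g >>.

Definition grmul x y : {malg F[G]} :=
  \sum_(g <- msupp x) \sum_(h <- msupp y) << x@_g * y@_h *g (g * h)%g >>.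

Lemma grmulw (d1 d2 : {fset G}) x y :
  (msupp x `<=` d1)%fset -> (msupp y `<=` d2)%fset ->
  grmul x y =
  \sum_(g <- d1) \sum_(h <- d2) << x@_g * y@_h *g (g * h)%g >>.
Proof.
move=> le1 le2; rewrite /grmul (big_fset_incl _ le1) /=.
  apply/eq_bigr=> g _; apply/big_fset_incl => // h _ /mcoeff_outdom ->.
  by rewrite mulr0 monalgU0.
move=> g _ /mcoeff_outdom xg.
by rewrite big1 => // h _; rewrite xg mul0r monalgU0.
Qed.

Lemma grmul0 x : grmul x 0 = 0.
Proof. by rewrite /grmul big1 // => g _; rewrite msupp0 big_seq_fset0. Qed.

Lemma gr0mul x : grmul 0 x = 0.
Proof. by rewrite /grmul msupp0 big_seq_fset0. Qed.

Lemma grmulUl c g y :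
  grmul << c *g g >> y = \sum_(h <- msupp y) << c * y@_h *g (g * h)%g >>.
Proof.
rewrite (grmulw msuppU_le (fsubset_refl _)) big_seq_fset1.
by apply/eq_bigr => h _; rewrite mcoeffUU.
Qed.

Lemma grmulUr c g x :
  grmul x << c *g g >> = \sum_(h <- msupp x) << x@_h * c *g (h * g)%g >>.
Proof.
rewrite (grmulw (fsubset_refl _) msuppU_le).
by apply/eq_bigr => h _; rewrite big_seq_fset1 mcoeffUU.
Qed.

Lemma grmulUU c d g h :
  grmul << c *g g >> << d *g h >> = << c * d *g (g * h)%g >>.
Proof. by rewrite (grmulw msuppU_le msuppU_le) !big_seq_fset1 !mcoeffUU. Qed.

Lemma grmul1l : left_id grone grmul.
Proof.
move=> x; rewrite grmulUl [RHS]monalgE.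
by apply/eq_bigr=> g _; rewrite mul1r mul1g.
Qed.

Lemma grmul1r : right_id grone grmul.
Proof.
move=> x; rewrite grmulUr [RHS]monalgE.
by apply/eq_bigr=> g _; rewrite mulr1 mulg1.
Qed.

Lemma grmulDl : left_distributive grmul +%R.
Proof.
move=> x1 x2 y; pose d := (msupp x1 `|` msupp x2)%fset.
rewrite (@grmulw d (msupp y) (x1 + x2)) ?msuppD_le //.
rewrite (@grmulw d (msupp y) x1) ?fsubsetUl //.
rewrite (@grmulw d (msupp y) x2) ?fsubsetUr //.
rewrite -big_split /=; apply/eq_bigr=> g _.
rewrite -big_split /=; apply/eq_bigr=> h _.
by rewrite mcoeffD mulrDl monalgUD.
Qed.

Lemma grmulDr : right_distributive grmul +%R.
Proof.
move=> y x1 x2; pose d := (msupp x1 `|` msupp x2)%fset.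
rewrite (@grmulw (msupp y) d y (x1 + x2)) ?msuppD_le //.
rewrite (@grmulw (msupp y) d y x1) ?fsubsetUl //.
rewrite (@grmulw (msupp y) d y x2) ?fsubsetUr //.
rewrite -big_split /=; apply/eq_bigr=> g _.
rewrite -big_split /=; apply/eq_bigr=> h _.
by rewrite mcoeffD mulrDr monalgUD.
Qed.

Lemma grmul_suml (I : Type) (r : seq I) (E : I -> {malg F[G]}) y :
  grmul (\sum_(i <- r) E i) y = \sum_(i <- r) grmul (E i) y.
Proof. exact: (big_morph (grmul^~ y) (fun _ _ => grmulDl _ _ _) (gr0mul y)). Qed.

Lemma grmul_sumr (I : Type) (r : seq I) (E : I -> {malg F[G]}) y :
  grmul y (\sum_(i <- r) E i) = \sum_(i <- r) grmul y (E i).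
Proof. exact: (big_morph (grmul y) (fun _ _ => grmulDr _ _ _) (grmul0 y)). Qed.

Lemma grmulA : associative grmul.
Proof.
move=> x y z; rewrite [x]monalgE !grmul_suml; apply/eq_bigr=> g _.
rewrite [y]monalgE grmul_suml !grmul_sumr grmul_suml; apply/eq_bigr=> h _.
rewrite [z]monalgE !grmul_sumr; apply/eq_bigr=> l _.
by rewrite !grmulUU mulrA mulgA.
Qed.

Lemma grone_neq0 : grone != 0.
Proof.
by apply/eqP=> /malgP /(_ 1%g) /eqP; rewrite mcoeffUU mcoeff0 oner_eq0.
Qed.

HB.instance Definition _ := GRing.Lmodule.on (groupRing F G).
HB.instance Definition _ := GRing.Zmodule_isNzRing.Build (groupRing F G)
  grmulA grmul1l grmul1r grmulDl grmulDr grone_neq0.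

(* The augmentation sum_i c_i [g_i] |-> sum_i c_i. *)
Definition augmentation (x : groupRing F G) : F :=
  \sum_(g <- msupp x) x@_g.

Definition augmentation_ideal : set (groupRing F G) :=
  [set x | augmentation x = 0].

Definition left_ideal (I : set (groupRing F G)) : Prop :=
  [/\ I 0, forall x y : groupRing F G, I x -> I y -> I (x + y)
    & forall a x : groupRing F G, I x -> I (a * x)].

(* The linear extension sum_i c_i [g_i] |-> sum_i c_i [f g_i]. *)
Definition gr_map (f : G -> G) (x : groupRing F G) : groupRing F G :=
  \sum_(g <- msupp x) << x@_g *g f g >>.

End GroupRing.

Definition gm_stable (k : fieldType) (U : groupScheme k) (alpha : gmAction U)
  (F : fieldType) (I : set (groupRing F (points U k^o))) : Prop :=
  forall (t : gm k) (x : groupRing F (points U k^o)),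
    I x -> I (gr_map (act_pt alpha t) x).

(* Main.v *)
Require Import Defs.
From HB Require Import structures.
From mathcomp Require Import all_boot all_order all_algebra.
From mathcomp Require Import finmap boolp classical_sets functions cardinality.
From mathcomp Require Import monalg zify.
Set Implicit Arguments.
Unset Strict Implicit.
Unset Printing Implicit Defensive.
Import Order.TTheory GRing.Theory Num.Theory.
Local Open Scope ring_scope.
Local Open Scope classical_set_scope.

(** Write A for the coordinate ring of U, m for the ideal of the identity and
    delta t for the automorphism of A by which t in k^* acts.

    Geometry: for g in U(k) the orbit t |-> t.g extends to a polynomial map from
    the affine line to U that sends 0 to the identity (orbit_polynomial_map).
    The action grades A. A homogeneous element of m of degree d <= 0 lies in
    m^2, since otherwise a linear functional on m / m^2 that is concentrated in
    degree d would be a tangent vector of nonpositive weight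
    (tangent_weight_vector). Let J be the ideal generated by the homogeneous
    elements of m of degree <= 0. It has finitely many homogeneous generators,
    and the inclusion in m^2 improves to J = mJ. By Nakayama's lemma some
    element of 1 + m kills J, and so does its component b of degree 0. But
    1 - b has degree 0 and lies in m, hence in J, so b is idempotent
    (idempotent_annihilator). As U is connected, b vanishes at no rational
    point, so J vanishes at all of them. Modulo J, every function on U is a
    constant plus terms of positive degree, and a term of degree d restricts to
    a multiple of t^d on the orbit of g.

    Combinatorics: let x = sum_i c_i [g_i] be in I with sum_i c_i <> 0, and put
    f t = sum_i c_i [t.g_i], where 0.g is the identity. Then f t lies in I for
    t <> 0, and f 0 is a unit of the group ring, so it is enough to see that f 0
    is a left combination of values f s with s <> 0 (value_at0_polynomial).
    This is an instance of van der Corput differencing. The polynomial maps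
    k -> U(k) of bounded degree and the translations of the line generate a
    nilpotent group: as U is a group of unitriangular matrices, there is a
    filtration of these maps by normal subgroups such that translations act
    trivially on the successive quotients (layer_step). Climbing it, one finds a
    relation f t + sum_j a_j(t) f (t + s_j) = 0 with all s_j <> 0
    (eliminable_step), whose value at t = 0 is the assertion. *)

(** * Eliminating a value by differences *)

Section Elimination.
Variables (K : zmodType) (G : groupType) (F : fieldType).
Implicit Types (s t : K) (g h : K -> G) (f : K -> groupRing F G).
Implicit Types (S N : set (K -> G)) (B : seq K).

Definition group_elt (c : F) (g : G) : groupRing F G := << c *g g >>.

Lemma group_eltM c d (g h : G) :
  group_elt c g * group_elt d h = group_elt (c * d) (g * h)%g.
Proof. exact: grmulUU. Qed.

Definition shift s g : K -> G := fun t => g (t + s).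
Definition fmul g h : K -> G := fun t => (g t * h t)%g.
Definition finv g : K -> G := fun t => (g t)^-1%g.

Definition expansion (l : seq (F * (K -> G))) t : groupRing F G :=
  \sum_(x <- l) group_elt x.1 (x.2 t).

Definition combination S f : Prop :=
  exists2 l, forall x, x \in l -> S x.2 & f =1 expansion l.

(** The triple (c, h, s) stands for the operator taking f to
    c [h t] f (t + s); a list stands for the identity plus the sum of its
    terms, see [apply]. The identity term is kept apart because it is what makes
    f 0 appear with coefficient 1. *)
Definition operator := seq (F * (K -> G) * K).

Definition apply (D : operator) f t : groupRing F G :=
  f t + \sum_(x <- D) group_elt x.1.1 (x.1.2 t) * f (t + x.2).

Definition admissible S B (D : operator) : Prop :=
  forall x, x \in D -> S x.1.2 /\ x.2 \notin B.

Definition compose (D D' : operator) : operator :=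
  D ++ D' ++ [seq (x.1.1 * y.1.1, fmul x.1.2 (shift x.2 y.1.2), x.2 + y.2)
             | x <- D, y <- D'].

Lemma apply_compose D D' f : apply (compose D D') f =1 apply D (apply D' f).
Proof.
move=> t; rewrite /compose /apply /= !big_cat /= big_allpairs_dep /=.
rewrite -[RHS]addrA; congr (_ + _).
under [X in _ = _ + X]eq_bigr do rewrite mulrDr mulr_sumr.
rewrite big_split /= addrCA; congr (_ + (_ + _)).
apply/eq_bigr => x _; apply/eq_bigr => y _.
by rewrite mulrA group_eltM addrA.
Qed.

Lemma applyD D f f' : apply D (f + f') =1 apply D f + apply D f'.
Proof.
move=> t; rewrite /apply /= [RHS]addrACA -big_split; congr (_ + _).
by apply/eq_bigr => x _; rewrite mulrDr.
Qed.

Lemma eq_apply D f f' : f =1 f' -> apply D f =1 apply D f'.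
Proof. by move=> /funext ->. Qed.

(** A composite also contains the translations by s' + s with s' from D' and s
    from D; they stay out of B because D' avoids the differences b - s. *)
Lemma admissible_compose N B (D D' : operator) :
  (forall s g h, N g -> N h -> N (fmul g (shift s h))) ->
  admissible N B D ->
  admissible N (B ++ [seq b - y | b <- B, y <- map snd D]) D' ->
  admissible N B (compose D' D).
Proof.
move=> Nmul admD admD' x; rewrite /compose !mem_cat => /or3P[|xD|].
- by move=> /admD'[Nx]; rewrite mem_cat negb_or => /andP[].
- exact: admD.
move=> /allpairsP[[y z] /= [yD' zD ->]] /=.
have [Ny] := admD' _ yD'; rewrite mem_cat negb_or => /andP[yB yzB].
have [Nz zB] := admD _ zD; split; first exact: Nmul.
apply: contra yzB => yzB; apply/allpairsP; exists (y.2 + z.2, z.2) => /=.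
by rewrite map_f // addrK.
Qed.

Lemma combination_apply N S D f :
  (forall s g h, N g -> S h -> S (fmul g (shift s h))) ->
  (forall x, x \in D -> N x.1.2) -> combination S f ->
  combination S (apply D f).
Proof.
move=> NS DN [l lS fl].
exists (l ++ [seq (x.1.1 * y.1, fmul x.1.2 (shift x.2 y.2)) | x <- D, y <- l]).
  move=> x; rewrite mem_cat => /orP[/lS//|].
  move=> /allpairsP[[y z] /= [yD zl ->]] /=; exact: NS (DN _ yD) (lS _ zl).
move=> t; rewrite /apply /expansion big_cat /= big_allpairs_dep /= fl.
congr (_ + _); apply/eq_bigr => x _; rewrite fl mulr_sumr.
by apply/eq_bigr => y _; rewrite group_eltM.
Qed.

(** The translations must be able to avoid any finite set, so that operators
    can be composed; in the end only 0 has to be avoided. *)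
Definition eliminable S : Prop :=
  forall f, combination S f -> forall B,
  exists2 D, admissible S B D & apply D f =1 (fun=> 0).

Definition coset h N : set (K -> G) := [set g | N (fmul (finv h) g)].

Record shift_group S : Prop := ShiftGroup {
  shift_groupM : forall g h, S g -> S h -> S (fmul g h);
  shift_groupV : forall g, S g -> S (finv g);
  shift_group_shift : forall s g, S g -> S (shift s g)
}.

(** One step of a normal series for the group generated by the maps K -> G and
    the translations of K, where [step_shift] makes the translations act
    trivially on the quotient S / N. *)
Record unipotent_step S N : Prop := Step {
  step_sub : N `<=` S;
  step_groupS : shift_group S;
  step_groupN : shift_group N;
  step_normal : forall g h, S h -> N g -> N (fmul (fmul (finv h) g) h);
  step_shift : forall s g, S g -> N (fmul (finv g) (shift s g))
}.

(** Operators with coefficients in N preserve the combinations of elements of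
    one coset of N, because translations fix the coset. *)
Lemma step_coset S N s g h h0 :
  unipotent_step S N -> S h0 -> N g -> coset h0 N h -> coset h0 N (fmul g (shift s h)).
Proof.
move=> [_ SG NG norm var] Sh0 Ng hh0; rewrite /coset /=.
have -> : fmul (finv h0) (fmul g (shift s h)) =
   fmul (fmul (fmul (finv h0) g) h0)
     (fmul (fmul (finv h0) (shift s h0)) (shift s (fmul (finv h0) h))).
  by apply/funext => t; rewrite /fmul /finv /shift !mulgA !mulgK.
apply: (shift_groupM NG); first exact: norm.
apply: (shift_groupM NG); first exact: var.
exact: (shift_group_shift NG).
Qed.

(** If D annihilates [h^-1] f, then its conjugate [h] D [h^-1] annihilates f.
    The coefficient a of a translation by s becomes h a (shift s h)^-1, which is
    a conjugate of an element of N times an element of N. *)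
Lemma eliminate_coset S N h f B :
  unipotent_step S N -> eliminable N -> S h -> combination (coset h N) f ->
  exists2 D, admissible N B D & apply D f =1 (fun=> 0).
Proof.
move=> [_ SG NG norm var] elimN Sh [l lN fl].
pose f' t := group_elt 1 (h t)^-1%g * f t.
have f'E : f' =1 expansion [seq (x.1, fmul (finv h) x.2) | x <- l].
  move=> t; rewrite /f' fl mulr_sumr /expansion big_map.
  by apply/eq_bigr => x _; rewrite group_eltM mul1r.
have [|D admD Df'] := elimN f' _ B.
  by eexists; last exact: f'E; move=> _ /mapP[x xl ->]; exact: lN.
exists [seq (x.1.1, fmul (fmul h x.1.2) (finv (shift x.2 h)), x.2) | x <- D].
  move=> _ /mapP[x xD ->] /=; have [Nx xB] := admD _ xD; split => //.
  have -> : fmul (fmul h x.1.2) (finv (shift x.2 h)) =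
     fmul (fmul (finv (finv h))
       (fmul x.1.2 (finv (fmul (finv h) (shift x.2 h))))) (finv h).
    by apply/funext => t; rewrite /fmul /finv !invgM !invgK !mulgA mulgK.
  apply: norm; first exact: (shift_groupV SG).
  by apply: (shift_groupM NG) => //; apply/(shift_groupV NG)/var.
move=> t; rewrite -[RHS](mulr0 (group_elt 1 (h t))) -(Df' t) /apply mulrDr.
rewrite /f' mulrA group_eltM mulgV mulr1 -[X in X + _]mul1r; congr (_ + _).
rewrite big_map mulr_sumr; apply/eq_bigr => x _ /=.
by rewrite !mulrA !group_eltM !mul1r !mulr1 /fmul /finv /shift.
Qed.

(** The cosets of N are annihilated one after the other: an operator that
    annihilates the part of f in one coset keeps the rest of f in the remaining
    cosets, so that the number of cosets drops. *)
Lemma eliminable_step S N : unipotent_step S N -> eliminable N -> eliminable S.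
Proof.
move=> SN elimN f [l lS fl] B.
have {elimN} elim_cosets (r : seq (K -> G)) :
    (forall h, h \in r -> S h) -> forall f' B',
    combination [set g | exists2 h, h \in r & coset h N g] f' ->
  exists2 D, admissible N B' D & apply D f' =1 (fun=> 0).
  elim: r => [|h r IHr] rS f' B' [l' l'r f'l'].
    exists [::] => // t; rewrite /apply f'l' /expansion big_nil addr0 big_seq big1 //.
    by move=> x /l'r[].
  pose p (x : F * (K -> G)) := `[< coset h N x.2 >].
  pose f1 := expansion [seq x <- l' | p x].
  pose f2 := expansion [seq x <- l' | ~~ p x].
  have f'E : f' = f1 + f2.
    apply/funext => t; rewrite f'l' /f1 /f2 /expansion /= (bigID p) /=.
    by congr (_ + _); rewrite big_filter.
  have Sh : S h by apply: rS; rewrite mem_head.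
  have [|D1 admD1 D1f1] := @eliminate_coset S N h f1 B' SN elimN Sh.
    eexists; last by move=> t; reflexivity.
    by move=> x; rewrite mem_filter => /andP[/asboolP].
  (* The operator D2 has to annihilate what D1 makes of f2. *)
  have [||D2 admD2 D2f2] := IHr _ (apply D1 f2)
      (B' ++ [seq b - y | b <- B', y <- map snd D1]).
  - by move=> g gr; apply: rS; rewrite inE gr orbT.
  - apply: (@combination_apply N) => [s g0 g1 Ng0 [g2 g2r g2g1]|x /admD1[]//|].
    + exists g2 => //; apply: (step_coset _ SN) => //.
      by apply: rS; rewrite inE g2r orbT.
    eexists; last by move=> t; reflexivity.
    move=> x; rewrite mem_filter => /andP[/asboolP nx /l'r[g]].
    by rewrite inE => /orP[/eqP-> //|gr xg]; exists g.
  exists (compose D2 D1).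
    apply: admissible_compose admD1 admD2 => s g0 g1 Ng0 Ng1.
    apply: (shift_groupM (step_groupN SN)) => //.
    exact: (shift_group_shift (step_groupN SN)).
  move=> t; rewrite apply_compose -(D2f2 t).
  apply: eq_apply => u; rewrite f'E applyD /=.
  by rewrite [X in X u]/GRing.add /= D1f1 add0r.
have [||D admD Df] := elim_cosets (map snd l) _ f B.
- by move=> _ /mapP[x xl ->]; exact: lS.
- exists l => // x xl; exists x.2; first exact: map_f.
  rewrite /coset /=.
  have /(step_shift SN 0) := lS _ xl; congr (N _); apply/funext => t.
  by rewrite /fmul /shift addr0.
by exists D => // x /admD[Nx xB]; split => //; exact: step_sub SN _ Nx.
Qed.

(** Here f is constant, hence annihilated by f t - f (t + s). *)
Lemma eliminable_trivial S : infinite_set [set: K] -> S (fun=> 1%g) ->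
  (forall g, S g -> g = fun=> 1%g) -> eliminable S.
Proof.
move=> Kinf S1 Strivial f [l lS fl] B.
have fE t t' : f t = f t'.
  rewrite !fl /expansion big_seq [RHS]big_seq.
  by apply/eq_bigr => x /lS/Strivial ->.
have [s sB] : exists s, s \notin B.
  apply: contrapT => /forallNP Ball; apply: Kinf.
  apply: (sub_finite_set _ (finite_seq B)) => s _ /=.
  by case: (boolP (s \in B)) => [|/(Ball s)].
exists [:: (- 1, fun=> 1%g, s)].
  by move=> x; rewrite inE => /eqP ->.
move=> t; rewrite /apply big_seq1 /= (fE (t + s) t).
have -> : group_elt (- 1) 1%g = - 1.
  by rewrite /group_elt monalgUN.
by rewrite mulN1r subrr.
Qed.

Lemma value_at0_in_ideal S (I : set (groupRing F G)) f :
  eliminable S -> left_ideal I -> combination S f ->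
  (forall s, s != 0 -> I (f s)) -> I (f 0).
Proof.
move=> elimS [I0 ID IM] Sf If.
have [D admD /(_ 0) /eqP] := elimS f Sf [:: 0].
rewrite /apply addr_eq0 => /eqP ->; rewrite -mulN1r; apply: (IM).
rewrite big_seq; apply: big_ind => // x /admD[_].
by rewrite add0r inE => x0; apply/IM/If.
Qed.

End Elimination.
(** * Polynomial maps into unitriangular matrices *)

Section Filtration.
Variables (k : fieldType) (n d : nat).
Implicit Types (X Y Z : 'M[{poly k}]_n) (t s : k) (v w : nat).

(** Entry (a, b) has degree at most d (b - a) - w, being 0 when this number is
    negative; additions avoid truncated subtraction. Both the
    difference with a translate and multiplication by a matrix of filtration 1
    increase w, and for w large nothing is left. *)
Definition filtered w X : Prop :=
  forall a b i, (X a b)`_i != 0 -> (i + w + d * a <= d * b)%N.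

Lemma filteredW v w X : (v <= w)%N -> filtered w X -> filtered v X.
Proof.
move=> vw Xw a b i /Xw; apply: leq_trans.
by rewrite leq_add2r leq_add2l.
Qed.

Lemma filteredD w X Y : filtered w X -> filtered w Y -> filtered w (X + Y).
Proof.
move=> Xw Yw a b i; rewrite mxE coefD => XYi.
have [X0|/Xw//] := eqVneq (X a b)`_i 0.
by apply: Yw; rewrite X0 add0r in XYi.
Qed.

Lemma filteredM v w X Y :
  filtered v X -> filtered w Y -> filtered (v + w) (X *m Y).
Proof.
move=> Xv Yw a b i; rewrite mxE coef_sum => XYi.
have [c XYc] : exists c, (X a c * Y c b)`_i != 0.
  apply/existsP; apply: contraR XYi => /existsPn XY0.
  by rewrite big1 // => c _; apply/eqP; rewrite -[_ == _]negbK XY0.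
have [j XYj] : exists j : 'I_i.+1, (X a c)`_j * (Y c b)`_(i - j) != 0.
  apply/existsP; apply: contraR XYc => /existsPn XY0.
  rewrite coefM big1 // => j _; apply/eqP; rewrite -[_ == _]negbK; exact: XY0.
move: XYj; rewrite mulf_eq0 negb_or => /andP[/Xv Xj /Yw Yj].
have ji : (j <= i)%N by rewrite -ltnS.
lia.
Qed.

Lemma filtered1 : filtered 0 1%:M.
Proof.
move=> a b i; rewrite !mxE; have [->|] := eqVneq a b; last by rewrite coef0 eqxx.
by rewrite coef1; case: i => [|i]; rewrite ?eqxx // addn0 add0n.
Qed.

Lemma filtered1D w X : filtered w X -> filtered 0 (1%:M + X).
Proof.
by move=> Xw; apply: filteredD; [exact: filtered1|exact: filteredW Xw].
Qed.

Lemma filteredX w X m : filtered w X -> filtered (m * w) (X ^+ m).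
Proof.
move=> Xw; elim: m => [|m IHm]; first exact: filtered1.
by rewrite exprS mulSn; apply: filteredM.
Qed.

Lemma filtered_eq0 w X : (d * n < w)%N -> filtered w X -> X = 0.
Proof.
move=> dnw Xw; apply/matrixP => a b; rewrite mxE; apply/polyP => i.
rewrite coef0; apply/eqP; apply: contraTT isT => /Xw.
have := leq_mul (leqnn d) (ltnW (ltn_ord b)); lia.
Qed.

(** The geometric series, which is finite since powers of X climb the
    filtration. *)
Lemma filtered_inverse w X : (0 < w)%N -> filtered w X ->
  exists2 Y, filtered w Y & (1%:M + X) *m (1%:M + Y) = 1%:M.
Proof.
move=> w0 Xw; have NXw : filtered w (- X).
  by move=> a b i; rewrite mxE coefN oppr_eq0 => /Xw.
pose m := (d * n)%N.
exists (\sum_(i < m) (- X) ^+ i.+1).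
  apply: (big_ind (filtered w)) => [a b i||i _].
  - by rewrite mxE coef0 eqxx.
  - exact: filteredD.
  by apply: filteredW (filteredX NXw); rewrite leq_pmull.
have -> : 1%:M + \sum_(i < m) (- X) ^+ i.+1 = \sum_(i < m.+1) (- X) ^+ i.
  by rewrite big_ord_recl expr0.
have X0 : (- X) ^+ m.+1 = 0.
  apply: filtered_eq0 (filteredX NXw).
  by rewrite -/m (leq_trans (ltnSn _)) // leq_pmulr.
have := subrX1 (- X) m.+1; rewrite X0 sub0r => /(congr1 -%R).
by rewrite opprK -mulNr opprB opprK => /esym.
Qed.

Definition mxeval t X : 'M[k]_n := map_mx (horner_eval t) X.

Lemma mxevalM t X Y : mxeval t (X *m Y) = mxeval t X *m mxeval t Y.
Proof. exact: map_mxM. Qed.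

Lemma mxeval1D t X : mxeval t (1%:M + X) = 1%:M + mxeval t X.
Proof. by rewrite /mxeval map_mxD map_mx1. Qed.

Definition mxshift s X := map_mx (fun p : {poly k} => p \Po ('X + s%:P)) X.

Lemma mxeval_shift s t X : mxeval t (mxshift s X) = mxeval (t + s) X.
Proof.
apply/matrixP => a b; rewrite !mxE /horner_eval horner_comp.
by rewrite hornerD hornerX hornerC.
Qed.

Lemma coef_comp_XaddC (p : {poly k}) s i :
  (forall j, (i < j)%N -> p`_j = 0) -> (p \Po ('X + s%:P))`_i = p`_i.
Proof.
move=> p0; rewrite comp_polyE coef_sum.
have XsE : 'X + s%:P = 'X - (- s)%:P :> {poly k} by rewrite polyCN opprK.
have Xs_small j : (j < i)%N -> (('X + s%:P) ^+ j)`_i = 0.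
  by move=> ji; rewrite nth_default // XsE size_exp_XsubC.
have Xs_lead : (('X + s%:P) ^+ i)`_i = 1.
  have /monicP := monic_exp i (monicXsubC (- s)).
  by rewrite -XsE lead_coefE XsE size_exp_XsubC.
have [ip|pi] := ltnP i (size p).
  rewrite (bigD1 (Ordinal ip)) //= coefZ Xs_lead mulr1 big1 ?addr0 // => j.
  rewrite -val_eqE /= => ji; rewrite coefZ.
  have [/Xs_small->|ij] := ltnP j i; first by rewrite mulr0.
  by rewrite p0 ?mul0r // ltn_neqAle eq_sym ji.
rewrite [in RHS]nth_default // big1 // => j _.
by rewrite coefZ Xs_small ?mulr0 // (leq_trans (ltn_ord j)).
Qed.

(** Translation preserves the leading coefficient of a polynomial. *)
Lemma filtered_shiftB w s X : filtered w X -> filtered w.+1 (mxshift s X - X).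
Proof.
move=> Xw a b i; rewrite !mxE coefB subr_eq0 => Xsi.
have [j ij Xj] : exists2 j, (i < j)%N & (X a b)`_j != 0.
  apply: contrapT => noj; move/eqP: Xsi; apply; apply: coef_comp_XaddC => j ij.
  by apply/eqP; apply: contrapT => /negP Xj; apply: noj; exists j.
by have := Xw _ _ _ Xj; lia.
Qed.

Lemma filtered_shift w s X : filtered w X -> filtered w (mxshift s X).
Proof.
move=> Xw; rewrite -(subrK X (mxshift s X)); apply: filteredD => //.
exact: filteredW (leqnSn w) (filtered_shiftB Xw).
Qed.

Section Layers.
Variables (G : groupType) (rho : G -> 'M[k]_n).
Hypothesis rhoM : forall g h, rho (g * h)%g = rho g *m rho h.
Hypothesis rho1 : rho 1%g = 1%:M.

Definition layer w : set (k -> G) :=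
  [set g | exists2 X, filtered w X & forall t, rho (g t) = mxeval t (1%:M + X)].

Lemma layer_inverse w g X : (0 < w)%N -> filtered w X ->
    (forall t, rho (g t) = mxeval t (1%:M + X)) ->
  exists2 Y, filtered w Y & (forall t, rho (finv g t) = mxeval t (1%:M + Y)) /\
    (1%:M + Y) *m (1%:M + X) = 1%:M.
Proof.
move=> w0 Xw gX; have [Y Yw XY] := filtered_inverse w0 Xw.
exists Y => //; split; last exact: mulmx1C.
move=> t; have E : mxeval t ((1%:M + X) *m (1%:M + Y)) = 1%:M.
  by rewrite XY /mxeval map_mx1.
by rewrite -[LHS]mulmx1 -E mxevalM mulmxA -gX -rhoM mulVg rho1 mul1mx.
Qed.

Lemma layer_group w : (0 < w)%N -> shift_group (layer w).
Proof.
move=> w0; split.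
- move=> g h [X Xw gX] [Y Yw hY]; exists (X + Y + X *m Y).
    apply: filteredD; first exact: filteredD.
    by apply: (filteredW (leq_addl w w)); apply: filteredM.
  move=> t; rewrite /fmul rhoM gX hY -mxevalM mulmxDl mul1mx mulmxDr mulmx1.
  by rewrite -!addrA (addrCA X Y).
- move=> g [X Xw gX]; have [Y Yw [gY _]] := layer_inverse w0 Xw gX.
  by exists Y.
move=> s g [X Xw gX]; exists (mxshift s X); first exact: filtered_shift.
by move=> t; rewrite /shift gX !mxeval1D mxeval_shift.
Qed.

(** With 1 + Y the inverse of 1 + X, conjugating 1 + Z gives
    1 + (1 + Y) Z (1 + X), and comparing 1 + X with its translate gives
    1 + (1 + Y) (mxshift s X - X). *)
Lemma layer_step w : (0 < w)%N -> unipotent_step (layer w) (layer w.+1).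
Proof.
move=> w0; split; [|exact: layer_group|exact: layer_group| |].
- by move=> g [X Xw gX]; exists X => //; exact: filteredW Xw.
- move=> g h [X Xw hX] [Z Zw gZ]; have [Y Yw [hY YX]] := layer_inverse w0 Xw hX.
  exists ((1%:M + Y) *m Z *m (1%:M + X)).
    rewrite -[w.+1]addn0; apply: filteredM; last exact: filtered1D Xw.
    by rewrite -[w.+1]add0n; apply: filteredM => //; exact: filtered1D Yw.
  move=> t; rewrite /fmul !rhoM hY hX gZ -!mxevalM; congr (mxeval t _).
  by rewrite [_ *m (1%:M + Z)]mulmxDr mulmx1 [LHS]mulmxDl YX.
move=> s g [X Xw gX]; have [Y Yw [gY YX]] := layer_inverse w0 Xw gX.
exists ((1%:M + Y) *m (mxshift s X - X)).
  rewrite -[w.+1]add0n; apply: filteredM; last exact: filtered_shiftB.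
  exact: filtered1D Yw.
move=> t; rewrite /fmul /shift rhoM gY gX.
rewrite [mxeval (t + s) _]mxeval1D -mxeval_shift -mxeval1D -mxevalM.
have -> : 1%:M + mxshift s X = (1%:M + X) + (mxshift s X - X).
  by rewrite -addrA [X + _]addrC subrK.
by rewrite mulmxDr YX.
Qed.

Lemma eliminable_layer (F : fieldType) w : infinite_set [set: k] ->
  injective rho -> (0 < w)%N -> eliminable F (layer w).
Proof.
move=> kinf rho_inj w0; have [m] := ubnP (d * n + 1 - w).
elim: m w w0 => // m IHm w w0; rewrite ltnS => wm.
have [dnw|] := ltnP (d * n) w; last first.
  move=> wdn; apply: eliminable_step (layer_step w0) _; apply: IHm => //; lia.
apply: eliminable_trivial => //.
  exists 0; first by move=> a b i; rewrite mxE coef0 eqxx.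
  by move=> t; rewrite rho1 addr0 /mxeval map_mx1.
move=> g [X Xw gX]; apply/funext => t; apply: rho_inj.
by rewrite gX (filtered_eq0 dnw Xw) addr0 rho1 /mxeval map_mx1.
Qed.

End Layers.
End Filtration.

Section PolynomialMaps.
Variables (k F : fieldType) (n : nat) (G : groupType) (rho : G -> 'M[k]_n).
Hypothesis rhoM : forall g h, rho (g * h)%g = rho g *m rho h.
Hypothesis rho_unitri : forall g (i j : 'I_n), (j <= i)%N -> rho g i j = (i == j)%:R.
Hypothesis rho_inj : injective rho.

Definition polynomial_map (g : k -> G) : Prop :=
  exists X : 'M[{poly k}]_n, forall t i j, rho (g t) i j = (X i j).[t].

(** The image of 1 is an idempotent matrix of determinant 1. *)
Lemma unitriangular_morphism1 : rho 1%g = 1%:M.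
Proof.
have det1 : \det (rho 1%g) = 1.
  rewrite -det_tr det_trig; last first.
    apply/is_trig_mxP => i j ij; rewrite mxE rho_unitri; last exact: ltnW.
    by rewrite -val_eqE /= gtn_eqF.
  by rewrite big1 // => i _; rewrite mxE rho_unitri // eqxx.
have unit1 : rho 1%g \in unitmx by rewrite unitmxE det1 unitr1.
by apply: (can_inj (mulKmx unit1)); rewrite -rhoM mulg1 mulmx1.
Qed.

(** Only the entries above the diagonal matter, and d is chosen larger than
    all their degrees. *)
Lemma polynomial_map_layer (l : seq (k -> G)) :
  (forall g, g \in l -> polynomial_map g) ->
  exists d, forall g, g \in l -> layer d rho 1 g.
Proof.
elim: l => [|g l IHl] lpoly; first by exists 0%N.
have [|d ld] := IHl; first by move=> h hl; apply: lpoly; rewrite inE hl orbT.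
have [|X gX] := lpoly g; first exact: mem_head.
pose d' := \max_i \max_j size (X i j).
have layerW e h : (d <= e)%N -> layer d rho 1 h -> layer e rho 1 h.
  move=> de [Y Yd hY]; exists Y => // a b i /Yd.
  have [e' ->] : exists e', e = (d + e')%N by exists (e - d)%N; rewrite subnKC.
  rewrite !mulnDl => dab; have ab : (a <= b)%N by nia.
  by have := leq_mul (leqnn e') ab; lia.
exists (maxn d d') => h; rewrite inE => /orP[/eqP ->|/ld]; last first.
  exact/layerW/leq_maxl.
(* As the diagonal of rho is 1, only the part of X above it remains. *)
pose Y : 'M[{poly k}]_n := \matrix_(a, b) if (b <= a)%N then 0 else X a b.
exists Y.
  move=> a b i; rewrite mxE; case: leqP => [_|ab]; first by rewrite coef0 eqxx.
  move=> Xi; have id' : (i < d')%N.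
    rewrite (@leq_trans (size (X a b))) //.
      by rewrite ltnNge; apply: contra Xi => ?; rewrite nth_default.
    apply: leq_trans (leq_bigmax (F := fun j => size (X a j)) b) _.
    exact: (leq_bigmax (F := fun i => \max_j size (X i j))).
  have := leq_mul (leqnn (maxn d d')) ab; have := leq_maxr d d'; rewrite mulnS; lia.
move=> t; apply/matrixP => a b; rewrite /mxeval !mxE /horner_eval hornerD.
case: leqP => [ba|ab]; first by rewrite rho_unitri // horner0 addr0 -polyC_natr hornerC.
by rewrite gX -val_eqE /= (ltn_eqF ab) horner0 add0r.
Qed.

Lemma value_at0_polynomial (I : set (groupRing F G)) (l : seq (F * (k -> G))) :
  infinite_set [set: k] -> left_ideal I ->
  (forall x, x \in l -> polynomial_map x.2) ->
  (forall t, t != 0 -> I (expansion l t)) -> I (expansion l 0).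
Proof.
move=> kinf idI lpoly lI.
have [|d ld] := @polynomial_map_layer (map snd l).
  by move=> _ /mapP[x xl ->]; exact: lpoly.
apply: (@value_at0_in_ideal _ _ _ (layer d rho 1)) => //.
  by apply: eliminable_layer => //; exact: unitriangular_morphism1.
by exists l => // x xl; apply: ld; exact: map_f.
Qed.

End PolynomialMaps.
(** * Subspaces, functionals and characters of the multiplicative group *)

Section Subspaces.
Variables (k : fieldType) (V : lmodType k).

Definition subspace (W : set V) : Prop :=
  W 0 /\ forall c u v, W u -> W v -> W (c *: u + v).

Variable W : set V.
Hypothesis subW : subspace W.

Lemma subspaceD u v : W u -> W v -> W (u + v).
Proof. by move=> Wu Wv; rewrite -[u]scale1r; apply: subW.2. Qed.

Lemma subspaceZ c u : W u -> W (c *: u).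
Proof. by move=> Wu; rewrite -[_ *: _]addr0; apply: subW.2 => //; exact: subW.1. Qed.

Lemma subspace_sum (T : eqType) (r : seq T) (E : T -> V) :
  (forall x, x \in r -> W (E x)) -> W (\sum_(x <- r) E x).
Proof.
move=> WE; rewrite big_seq; elim/big_ind: _ => //; first exact: subW.1.
exact: subspaceD.
Qed.

Lemma subspaceZ_eq c u : c != 0 -> W (c *: u) -> W u.
Proof. by move=> c0 /(subspaceZ c^-1); rewrite scalerA mulVf // scale1r. Qed.

(** A subspace containing W and maximal among those that avoid x is a
    hyperplane complementary to the line of x. *)
Lemma functional_outside x : ~ W x ->
  exists D : {linear V -> k^o}, (forall w, W w -> D w = 0) /\ D x = 1.
Proof.
move=> Wx.
pose P (X : set V) := X = set0 \/ [/\ subspace X, W `<=` X & ~ X x].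
have [F FP totF|A [PA maxA]] := @Zorn_bigcup V P.
  have [[X0 FX0 [v0 X0v0]]|noX] :=
      pselect (exists2 X, F X & exists v, X v); last first.
    left; apply/seteqP; split => // v [X FX Xv].
    by case: noX; exists X => //; exists v.
  have FW X v : F X -> X v -> [/\ subspace X, W `<=` X & ~ X x].
    by move=> /FP[->|].
  have [subX0 WX0 _] := FW _ _ FX0 X0v0.
  right; split.
  - split; first by exists X0 => //; exact: subX0.1.
    move=> c u v [X1 FX1 X1u] [X2 FX2 X2v].
    have [X12|X21] := totF _ _ FX1 FX2.
      exists X2 => //; have [sub2 _ _] := FW _ _ FX2 X2v.
      by apply: sub2.2 => //; exact: X12.
    exists X1 => //; have [sub1 _ _] := FW _ _ FX1 X1u.
    by apply: sub1.2 => //; exact: X21.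
  - by move=> w Ww; exists X0 => //; exact: WX0.
  by move=> [X FX Xx]; have [_ _] := FW _ _ FX Xx.
have {PA}[subA WA Ax] : [/\ subspace A, W `<=` A & ~ A x].
  case: PA => // A0; suff /maxA : A `<` W by case; right; split.
  by rewrite A0; split; [exact: sub0set|move=> /(_ 0 subW.1)].
have complement y : exists c, A (y - c *: x).
  have [Ay|Ay] := pselect (A y); first by exists 0; rewrite scale0r subr0.
  pose B := [set v | exists c, A (v - c *: y)].
  have AB : A `<=` B by move=> v Av; exists 0; rewrite scale0r subr0.
  have : ~ P B.
    (* By maximality, the span of A and y contains x. *)
    apply: maxA; split => // BA; apply/Ay/BA.
    by exists 1; rewrite scale1r subrr; exact: subA.1.
  move=> PB; have {PB}[c xc] : B x.
    apply: contrapT => Bx; apply: PB; right; split => //; last first.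
      by move=> w /WA /AB.
    split; first by apply: AB; exact: subA.1.
    move=> c u v [c1 Au] [c2 Av]; exists (c * c1 + c2).
    by rewrite scalerDl -scalerA opprD addrACA -scalerBr; apply: subA.2.
  have c0 : c != 0 by apply/eqP => c0; rewrite c0 scale0r subr0 in xc.
  exists c^-1; rewrite -[y](scale1r) -(mulVf c0) -scalerA -scalerBr.
  have -> : c *: y - x = (- 1) *: (x - c *: y) + 0 by rewrite scaleN1r opprB addr0.
  rewrite -[_ *: _]addr0; apply: subA.2; last exact: subA.1.
  by apply: subA.2 => //; exact: subA.1.
have coeff_unique y c c' : A (y - c *: x) -> A (y - c' *: x) -> c = c'.
  move=> Ac Ac'; apply/eqP; apply: contrapT => /negP; rewrite -subr_eq0 => cc'.
  apply: Ax; rewrite -[x]scale1r -(mulVf cc') -scalerA -[_ *: _]addr0.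
  apply: subA.2; last exact: subA.1.
  have -> : (c - c') *: x = (- 1) *: (y - c *: x) + (y - c' *: x).
    by rewrite scaleN1r opprB scalerBl addrA subrK.
  exact: subA.2.
have [D AD] := choice complement.
have linD : linear (D : V -> k^o).
  move=> c u v; apply: (coeff_unique (c *: u + v)); first exact: AD.
  have -> : c *: u + v - (c *: (D u : k^o) + D v) *: x
     = c *: (u - D u *: x) + (v - D v *: x).
    by rewrite scalerDl scalerBr scalerA opprD addrACA.
  exact: subA.2.
pose linDm := GRing.isLinear.Build k V k^o _ (D : V -> k^o) linD.
pose DL : {linear V -> k^o} := HB.pack (D : V -> k^o) linDm.
exists DL; split => [w Ww|] /=.
  by apply: (coeff_unique w); [exact: AD|rewrite scale0r subr0; exact: WA].
apply: (coeff_unique x); first exact: AD.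
by rewrite scale1r subrr; exact: subA.1.
Qed.

End Subspaces.

Section Characters.
Variable k : fieldType.
Hypothesis k_infinite : infinite_set [set: k].

Lemma gm_val_neq0 (t : gm k) : gm_val t != 0.
Proof.
apply/eqP => t0; have /eqP := gm_valV t.
by rewrite t0 mul0r eq_sym oner_eq0.
Qed.

Definition gm_unit (t : k) (t0 : t != 0) : gm k := Gm (mulfV t0).

(** A power of t with nonzero exponent is not constant, because T (T^m - 1) has
    finitely many roots. *)
Lemma gm_separates (c d : int) : c != d ->
  exists t : gm k, gm_val t ^ c != gm_val t ^ d.
Proof.
wlog [m dE] : c d / exists m : nat, d = c + m.+1%:Z.
  move=> IH cd; have [lt_cd|le_dc] := ltP c d.
    by apply: IH => //; exists `|d - c|%N.-1; lia.
  have [||t] := IH d c; first by exists `|c - d|%N.-1; lia.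
    by rewrite eq_sym.
  by exists t; rewrite eq_sym.
move=> _; apply: contrapT => /forallNP eq_cd.
have [B _ Bm] := infinite_set_fset m.+3 k_infinite.
(* If t^c = t^d for all t in k^*, every element of k is a root of p. *)
pose p : {poly k} := 'X * ('X^(m.+1) - 1).
have p0 : p != 0 by rewrite mulf_neq0 ?polyX_eq0 // monic_neq0 // monic_Xn_sub_1.
have sp : size p = m.+3.
  rewrite /p size_mul ?polyX_eq0 //; last by rewrite monic_neq0 // monic_Xn_sub_1.
  by rewrite size_polyX size_Xn_sub_1.
suff /(max_poly_roots p0) : all (root p) B.
  by move=> /(_ (fset_uniq B)); rewrite sp ltnNge Bm.
apply/allP => t _; rewrite rootM rootX /root !hornerE.
case: eqVneq => //= t0; have /negP := eq_cd (gm_unit t0).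
rewrite negbK /= dE expfzDr // -subr_eq0 -{1}[t ^ c]mulr1 -mulrBr mulf_eq0.
by rewrite (negPf (expfz_neq0 _ t0)) /= subr_eq0 eq_sym subr_eq0.
Qed.

(** The characters of k^* are independent, also modulo a subspace. Subtracting
    s^c times the value at t from the value at s t removes the terms of degree c
    and multiplies those of degree d by s^d - s^c, which is nonzero for some
    s. *)
Lemma laurent_component (V : lmodType k) (W : set V) (r : seq (int * V)) d :
  subspace W -> (forall t : gm k, W (\sum_(x <- r) gm_val t ^ x.1 *: x.2)) ->
  W (\sum_(x <- r | x.1 == d) x.2).
Proof.
move=> subW; have [m] := ubnP (size r); elim: m r => // m IHm r rm Wr.
have [/allP rd|/allPn[y yr yd]] := boolP (all [pred x | x.1 == d] r).
  have := Wr (gm1 k); rewrite big_seq [X in _ -> W X]big_seq_cond.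
  under eq_bigr do rewrite exp1rz scale1r.
  congr (W _); apply: eq_bigl => x; case xr : (x \in r) => //=.
  exact/esym/rd.
have [s scd] := gm_separates yd.
pose f (x : int * V) := (x.1, (gm_val s ^ x.1 - gm_val s ^ y.1) *: x.2).
pose r' := [seq f x | x <- r & x.1 != y.1].
have r'm : (size r' < m)%N.
  rewrite ltnS in rm; rewrite size_map size_filter; apply: leq_trans rm.
  rewrite -(count_predC (fun x => x.1 != y.1) r) -addn1 leq_add2l.
  by rewrite -has_count; apply/hasP; exists y => //=; rewrite eqxx.
have : W (\sum_(x <- r' | x.1 == d) x.2).
  apply: IHm => // t; rewrite big_map big_filter; set S := (X in W X).
  have -> : S = (- gm_val s ^ y.1) *: (\sum_(x <- r) gm_val t ^ x.1 *: x.2)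
            + \sum_(x <- r) gm_val (gm_mul s t) ^ x.1 *: x.2.
    rewrite scaler_sumr -big_split /S [RHS](bigID (fun x => x.1 == y.1)) /=.
    rewrite [X in _ = X + _]big1 => [|x /eqP->].
      rewrite add0r; apply/eq_bigr => x _.
      rewrite !scalerA -scalerDl /= expfzMl mulrBr addrC mulNr; congr (_ *: _).
      by congr (- _ + _); exact: mulrC.
    by rewrite scalerA -scalerDl /= expfzMl mulNr addNr scale0r.
  exact: subW.2.
rewrite big_map big_filter_cond.
have -> : \sum_(x <- r | (x.1 != y.1) && ((f x).1 == d)) (f x).2 =
   (gm_val s ^ d - gm_val s ^ y.1) *: (\sum_(x <- r | x.1 == d) x.2).
  rewrite scaler_sumr; apply: eq_big => [x|x /andP[_ /eqP<-]] //=.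
  by case: (x.1 =P d) => [->|]; rewrite ?andbF // andbT eq_sym.
by apply: subspaceZ_eq => //; rewrite subr_eq0 eq_sym.
Qed.

End Characters.
(** * Algebras graded by an action of the multiplicative group *)

Section GradedAlgebra.
Variables (k : fieldType) (A : comAlgType k).
Variables (delta : gm k -> {lrmorphism A -> A}) (e : {lrmorphism A -> k^o}).
Hypothesis k_infinite : infinite_set [set: k].
Hypothesis delta1 : forall a, delta (gm1 k) a = a.
Hypothesis deltaM : forall s t a, delta (gm_mul s t) a = delta t (delta s a).
Hypothesis delta_laurent : forall a, exists r : seq (int * A),
  forall t, delta t a = \sum_(x <- r) gm_val t ^ x.1 *: x.2.
Hypothesis e_delta : forall t a, e (delta t a) = e a.

Definition homogeneous (d : int) (a : A) : Prop :=
  forall t, delta t a = gm_val t ^ d *: a.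

Definition graded (P : set int) (a : A) : Prop :=
  exists2 r : seq (int * A), forall x, x \in r -> P x.1 /\ homogeneous x.1 x.2
    & a = \sum_(x <- r) x.2.

Definition stable (W : set A) : Prop := forall t a, W a -> W (delta t a).

Lemma homogeneous_subspace d : subspace (homogeneous d).
Proof.
split=> [t|c u v hu hv t]; first by rewrite rmorph0 scaler0.
by rewrite linearP /= hu hv scalerDr !scalerA mulrC.
Qed.

Lemma homogeneousM c d a b :
  homogeneous c a -> homogeneous d b -> homogeneous (c + d) (a * b).
Proof.
move=> ha hb t; rewrite rmorphM /= ha hb -scalerAl -scalerAr scalerA.
by rewrite expfzDr ?gm_val_neq0.
Qed.

Lemma graded_subspace P : subspace (graded P).
Proof.
split=> [|c _ _ [r Pr ->] [s Ps ->]]; first by exists [::]; rewrite ?big_nil.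
exists ([seq (x.1, c *: x.2) | x <- r] ++ s).
  move=> x; rewrite mem_cat => /orP[/mapP[y yr ->]|/Ps//] /=.
  have [Py hy] := Pr _ yr; split => //.
  exact: subspaceZ (homogeneous_subspace _) _ _ hy.
by rewrite big_cat big_map scaler_sumr.
Qed.

Lemma graded_homogeneous (P : set int) d a : P d -> homogeneous d a -> graded P a.
Proof.
move=> Pd hd; exists [:: (d, a)]; last by rewrite big_seq1.
by move=> x; rewrite inE => /eqP->.
Qed.

Lemma gradedM (P : set int) a b : (forall c d, P c -> P d -> P (c + d)) ->
  graded P a -> graded P b -> graded P (a * b).
Proof.
move=> PD [r Pr ->] [s Ps ->]; rewrite mulr_suml.
apply: subspace_sum => [|x /Pr[Px hx]]; first exact: graded_subspace.
rewrite mulr_sumr; apply: subspace_sum => [|y /Ps[Py hy]].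
  exact: graded_subspace.
exact: graded_homogeneous (PD _ _ Px Py) (homogeneousM hx hy).
Qed.

(** The component of degree c enters delta t (sum of r) with the factor t^c, so
    that [laurent_component] separates the degrees. *)
Lemma homogeneous_component W (r : seq (int * A)) d : subspace W -> stable W ->
  (forall x, x \in r -> homogeneous x.1 x.2) -> W (\sum_(x <- r) x.2) ->
  W (\sum_(x <- r | x.1 == d) x.2).
Proof.
move=> subW stW hr Wr; apply: laurent_component => // t.
have := stW t _ Wr; rewrite rmorph_sum /= big_seq [X in _ -> W X]big_seq.
by congr (W _); apply: eq_bigr => x /hr ->.
Qed.

(** As p has no component of degree d, the component of a + p in this degree
    is a. *)
Lemma graded_complement W (P : set int) d a p : subspace W -> stable W ->
  homogeneous d a -> graded P p -> ~ P d -> W (a + p) -> W a.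
Proof.
move=> subW stW ha [r Pr ->] Pd Wap.
have -> : a = \sum_(x <- (d, a) :: r | x.1 == d) x.2.
  rewrite big_cons eqxx /= big_seq_cond big1 ?addr0 // => x.
  by move=> /andP[/Pr[Px _] /eqP xd]; rewrite xd in Px.
apply: homogeneous_component => //; last by rewrite big_cons.
by move=> x; rewrite inE => /predU1P[->//|/Pr[]].
Qed.

(** The Laurent coefficients of t |-> delta t a are homogeneous, by comparison
    of coefficients in delta (t s) a = delta s (delta t a); at t = 1 they add up
    to a. *)
Lemma gradedT a : graded setT a.
Proof.
have [r ar] := delta_laurent a.
exists [seq (d, \sum_(x <- r | x.1 == d) x.2) | d <- undup (map fst r)].
  move=> _ /mapP[d _ ->]; split => //= s; apply/eqP; rewrite -subr_eq0; apply/eqP.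
  pose r' := [seq (x.1, delta s x.2 - gm_val s ^ x.1 *: x.2) | x <- r].
  have := @laurent_component k k_infinite A [set 0] r' d; rewrite big_map /=.
  rewrite sumrB rmorph_sum /= => comp; rewrite scaler_sumr -[RHS]comp.
  - by congr (_ - _); apply: eq_bigr => x /eqP->.
  - by split => // c u v /= -> ->; rewrite scaler0 addr0.
  move=> t /=; rewrite big_map /=; apply/eqP.
  under eq_bigr do rewrite scalerBr scalerA.
  rewrite sumrB subr_eq0; apply/eqP; transitivity (delta s (delta t a)).
    by rewrite ar linear_sum; apply: eq_bigr => x _; rewrite linearZ.
  by rewrite -deltaM ar; apply: eq_bigr => x _; rewrite /= expfzMl.
rewrite big_map /= -[a in LHS]delta1 ar.
transitivity (\sum_(x <- r) x.2).
  by apply: eq_bigr => x _; rewrite /= exp1rz scale1r.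
under [RHS]eq_bigr do rewrite big_mkcond.
rewrite exchange_big big_seq [RHS]big_seq; apply: eq_bigr => x xr.
rewrite -big_mkcond (eq_bigl (pred1 x.1)) => [|d]; last exact: eq_sym.
by rewrite -big_filter filter_pred1_uniq ?undup_uniq ?mem_undup ?map_f // big_seq1.
Qed.

(** The identity is a fixed point. *)
Lemma homogeneous_counit0 d a : d != 0 -> homogeneous d a -> e a = 0.
Proof.
move=> d0 ha; have [t] := gm_separates k_infinite d0.
rewrite expr0z => td; have := e_delta t a; rewrite ha linearZ => /eqP.
rewrite -subr_eq0 -[X in _ - X]scale1r -scalerBl scaler_eq0 subr_eq0.
by rewrite (negPf td) => /eqP.
Qed.

Lemma graded_counit0 (P : set int) a : ~ P 0 -> graded P a -> e a = 0.
Proof.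
move=> P0 [r Pr ->]; rewrite rmorph_sum big_seq big1 // => x /Pr[Px].
by apply: homogeneous_counit0; apply/eqP => x0; rewrite x0 in Px.
Qed.

(** The ideals m and m^2 of the identity. *)
Definition aug : set A := [set a | e a = 0].

Lemma aug_subspace : subspace aug.
Proof.
split=> [|c u v]; rewrite /aug /= ?rmorph0 // => u0 v0.
by rewrite linearP /= u0 v0 scaler0 addr0.
Qed.

Lemma counit_in_alg c : e c%:A = c.
Proof. by rewrite linearZ /= rmorph1 [_ *: _]mulr1. Qed.

Lemma subr_counit a : aug (a - (e a)%:A).
Proof. by rewrite /aug /= rmorphB /= counit_in_alg subrr. Qed.

Definition aug2 : set A := [set a | exists2 r : seq (A * A),
  forall x, x \in r -> aug x.1 /\ aug x.2 & a = \sum_(x <- r) x.1 * x.2].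

Lemma aug2_subspace : subspace aug2.
Proof.
split=> [|c _ _ [r Pr ->] [s Ps ->]]; first by exists [::]; rewrite ?big_nil.
exists ([seq (c *: x.1, x.2) | x <- r] ++ s).
  move=> x; rewrite mem_cat => /orP[/mapP[y yr ->]|/Ps//] /=.
  have [Py hy] := Pr _ yr; split => //.
  exact: subspaceZ aug_subspace _ _ Py.
rewrite big_cat big_map scaler_sumr; congr (_ + _).
by apply: eq_bigr => x _; exact: scalerAl.
Qed.

Lemma aug2_stable : stable aug2.
Proof.
move=> t _ [r Pr ->]; exists [seq (delta t x.1, delta t x.2) | x <- r].
  by move=> _ /mapP[x /Pr[x1 x2] ->]; rewrite /aug /= !e_delta.
by rewrite big_map rmorph_sum; apply: eq_bigr => x _; rewrite rmorphM.
Qed.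

Lemma aug2M a b : aug a -> aug b -> aug2 (a * b).
Proof.
move=> ua ub; exists [:: (a, b)]; last by rewrite big_seq1.
by move=> x; rewrite inE => /eqP->.
Qed.

Section NonpositiveGenerators.
Variables (n : nat) (x : 'I_n -> A) (d : 'I_n -> int).
Hypothesis x_homogeneous : forall i, homogeneous (d i) (x i).
Hypothesis d_le0 : forall i, d i <= 0.
Hypothesis x_aug : forall i, aug (x i).

(** For C = A this is the ideal J generated by the x_i, and for C = m it is
    mJ. *)
Definition combos (C : set A) : set A :=
  [set a | exists2 c : 'I_n -> A, forall i, C (c i) & a = \sum_i c i * x i].

Definition positive_part : set A := graded [set c | 0 < c].

(** The sum k + J + A_+, where A_+ is spanned by the homogeneous elements of
    positive degree. Being a subalgebra, it is all of A as soon as it contains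
    generators. *)
Definition almost_positive : set A := [set a | exists c j p,
  [/\ combos setT j, positive_part p & a = c%:A + j + p]].

Lemma combos_subspace C : subspace C -> subspace (combos C).
Proof.
move=> subC; split=> [|c _ _ [a Ca ->] [b Cb ->]].
  exists (fun=> 0) => [_|]; first exact: subC.1.
  by rewrite big1 // => i _; rewrite mul0r.
exists (fun i => c *: a i + b i) => [i|]; first exact: subC.2.
rewrite scaler_sumr -big_split; apply: eq_bigr => i _.
by rewrite mulrDl scalerAl.
Qed.

Lemma combos_stable C : subspace C -> stable C -> stable (combos C).
Proof.
move=> subC stC t _ [c Cc ->]; exists (fun i => gm_val t ^ d i *: delta t (c i)).
  by move=> i; apply: subspaceZ => //; exact: stC.
rewrite rmorph_sum; apply: eq_bigr => i _.
by rewrite rmorphM /= x_homogeneous -scalerAr scalerAl.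
Qed.

Lemma combosM (C : set A) a b : (forall c, C (a * c)) -> combos setT b ->
  combos C (a * b).
Proof.
move=> CM [c Cc ->]; exists (fun i => a * c i) => [i|]; first exact: CM.
by rewrite mulr_sumr; apply: eq_bigr => i _; rewrite mulrA.
Qed.

Lemma combos_aug a b : aug a -> combos setT b -> combos aug (a * b).
Proof.
by move=> a0; apply: combosM => c; rewrite /aug /= rmorphM /= a0 mul0r.
Qed.

Lemma subspaceT (V : lmodType k) : subspace [set: V].
Proof. by []. Qed.

Lemma combos_gen i : combos setT (x i).
Proof.
exists (fun j => (j == i)%:R) => //.
rewrite (bigD1 i) //= eqxx mul1r big1 ?addr0 // => j /negPf->.
by rewrite mul0r.
Qed.

Lemma combosT_counit a : combos setT a -> e a = 0.
Proof.
move=> [c _ ->]; rewrite rmorph_sum big1 // => i _.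
by rewrite rmorphM /= x_aug mulr0.
Qed.

Lemma positive_partM a b :
  positive_part a -> positive_part b -> positive_part (a * b).
Proof. by apply: gradedM => c c'; exact: addr_gt0. Qed.

Lemma almost_positive_subspace : subspace almost_positive.
Proof.
split=> [|c u v [c1 [j1 [p1 [J1 P1 ->]]]] [c2 [j2 [p2 [J2 P2 ->]]]]].
  exists 0, 0, 0; split; rewrite ?scale0r ?addr0 //.
    exact: (combos_subspace (@subspaceT A)).1.
  exact: (graded_subspace _).1.
exists (c * c1 + c2), (c *: j1 + j2), (c *: p1 + p2); split.
- by apply: (combos_subspace (@subspaceT A)).2.
- by apply: (graded_subspace _).2.
by rewrite !scalerDr scalerDl scalerA addrACA (addrACA _ (c *: j1)).
Qed.

Lemma almost_positiveM a b :
  almost_positive a -> almost_positive b -> almost_positive (a * b).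
Proof.
move=> [c1 [j1 [p1 [J1 P1 ->]]]] [c2 [j2 [p2 [J2 P2 ->]]]].
have subJ := combos_subspace (@subspaceT A).
have subP : subspace positive_part by exact: graded_subspace.
exists (c1 * c2), (c1 *: j2 + (j2 * p1 + (c2%:A + j2 + p2) * j1)),
  (c1 *: p2 + c2 *: p1 + p1 * p2); split.
- apply: subJ.2 => //; apply: subspaceD => //.
    by rewrite mulrC; apply: combosM.
  exact: combosM.
- apply: subspaceD; [exact: subP| |exact: positive_partM].
  by apply: subP.2 => //; exact: subspaceZ.
rewrite 2!mulrDl (mulrC j1) -scalerAl mul1r 2!scalerDr 2!(mulrDr p1) -scalerAr.
rewrite mulr1 scalerA (mulrC p1 j2).
exact: (@GRing.add A).[AC (4*3) (1*(2*(6*4))*(3*5*7))].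
Qed.

Lemma aug_almost_positive a : almost_positive a -> aug a ->
  exists j p, [/\ combos setT j, positive_part p & a = j + p].
Proof.
move=> [c [j [p [J P ->]]]]; rewrite /aug /= !rmorphD /= (combosT_counit J).
rewrite (graded_counit0 _ P) /=; last by rewrite ltxx.
rewrite !addr0 counit_in_alg => ->.
by exists j, p; rewrite scale0r add0r.
Qed.

Hypothesis A_almost_positive : forall a, almost_positive a.

(** Modulo J, the element a of m belongs to A_+, whereas its degree is not
    positive; J contains the component of a in this degree since it is
    stable. *)
Lemma nonpositive_combos c a : c <= 0 -> homogeneous c a -> aug a ->
  combos setT a.
Proof.
move=> c0 ha /(aug_almost_positive (A_almost_positive a))[j [p [J P aE]]].
have subJ := combos_subspace (@subspaceT A).
apply: (@graded_complement _ [set c | 0 < c] c a (- p)) => //.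
- by apply: combos_stable.
- by rewrite -scaleN1r; apply: subspaceZ => //; exact: graded_subspace.
- by apply/negP; rewrite -leNgt.
by rewrite aE addrK.
Qed.

(** From m = J + A_+ one gets that m^2 is contained in mJ + A_+, and the part
    in A_+ is discarded for degree reasons. *)
Lemma aug2_combos c a : c <= 0 -> homogeneous c a -> aug2 a -> combos aug a.
Proof.
move=> c0 ha [r Pr aE].
have subJ := combos_subspace aug_subspace.
have [p P ap] : exists2 p, positive_part p & combos aug (a + p).
  have subP : subspace positive_part by exact: graded_subspace.
  pose W := [set b | exists2 p, positive_part p & combos aug (b + p)].
  have subW : subspace W.
    split=> [|z u v [p Pp up] [q Pq vq]].
      by exists 0; rewrite ?addr0; [exact: subP.1|exact: subJ.1].
    exists (z *: p + q); first exact: subP.2.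
    by rewrite addrACA -scalerDr; apply: subJ.2.
  suff : W a by [].
  rewrite aE; apply: subspace_sum => // y /Pr[y1 y2].
  have [j1 [p1 [J1 P1 y1E]]] := aug_almost_positive (A_almost_positive _) y1.
  have [j2 [p2 [J2 P2 y2E]]] := aug_almost_positive (A_almost_positive _) y2.
  exists (- (p1 * p2)).
    by rewrite -scaleN1r; apply: subspaceZ => //; exact: positive_partM.
  have -> : y.1 * y.2 - p1 * p2 = y.1 * j2 + p2 * j1.
    rewrite y2E mulrDr -addrA; congr (_ + _).
    by rewrite y1E mulrDl addrK mulrC.
  apply: subspaceD => //; apply: combos_aug => //.
  by apply: graded_counit0 P2; rewrite /= ltxx.
apply: (@graded_complement _ [set c | 0 < c] c a p) => //.
- apply: combos_stable => //; first exact: aug_subspace.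
  by move=> t b; rewrite /aug /= e_delta.
- by apply/negP; rewrite -leNgt.
Qed.

Hypothesis nonpositive_aug2 :
  forall c a, c <= 0 -> homogeneous c a -> aug a -> aug2 a.

(** Nakayama's lemma: as x = c x with the entries of c in m, the determinant of
    1 - c kills every x_i, and it is 1 at the identity. *)
Lemma annihilator : exists2 b, e b = 1 & forall i, b * x i = 0.
Proof.
have [c cP] : exists c : 'I_n -> 'I_n -> A,
    forall i, (forall j, aug (c i j)) /\ x i = \sum_j c i j * x j.
  have /choice[c cP] : forall i, exists c : 'I_n -> A,
      (forall j, aug (c j)) /\ x i = \sum_j c j * x j.
    move=> i; have [|c] := @aug2_combos (d i) (x i) (d_le0 i) (x_homogeneous i).
      exact: nonpositive_aug2 (d_le0 i) (x_homogeneous i) (x_aug i).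
    by exists c.
  by exists c.
pose C : 'M[A]_n := 1%:M - \matrix_(i, j) c i j.
exists (\det C).
  have -> : e (\det C) = \det (map_mx e C) by rewrite det_map_mx.
  have -> : map_mx e C = 1%:M; last by rewrite det1.
  by apply/matrixP => i j; rewrite !mxE rmorphB /= rmorph_nat (cP i).1 subr0.
move=> i; pose X : 'cV[A]_n := \col_i x i.
have CX : C *m X = 0.
  apply/matrixP => j z; rewrite mulmxBl mul1mx !mxE.
  apply/eqP; rewrite subr_eq0 {1}(cP j).2; apply/eqP.
  by apply: eq_bigr => l _; rewrite !mxE.
have /matrixP/(_ i 0) : \adj C *m C *m X = 0 by rewrite -mulmxA CX mulmx0.
by rewrite mul_adj_mx mul_scalar_mx !mxE.
Qed.

(** The component b of degree 0 of an annihilator of J that is 1 at the identity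
    is again such an annihilator, as J is graded. Now 1 - b is in m and of
    degree 0, hence in J, and b kills it. *)
Lemma idempotent_annihilator :
  exists b, [/\ e b = 1, forall i, b * x i = 0 & b * (1 - b) = 0].
Proof.
have [b eb bx] := annihilator; pose W := [set a | forall i, a * x i = 0].
have subW : subspace W.
  split=> [i|c u v Wu Wv i]; first by rewrite mul0r.
  by rewrite mulrDl -scalerAl Wu Wv scaler0 addr0.
have stW : stable W.
  move=> t a Wa i; have : delta t (a * x i) = 0 by rewrite Wa rmorph0.
  rewrite rmorphM /= x_homogeneous -scalerAr => /eqP; rewrite scaler_eq0.
  by rewrite (negPf (expfz_neq0 _ (gm_val_neq0 t))) /= => /eqP.
have [r Pr bE] := gradedT b.
pose b0 := \sum_(y <- r | y.1 == 0) y.2.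
have Wb0 : W b0.
  apply: (@homogeneous_component W r 0 subW stW) => [y /Pr[]//|].
  by rewrite -bE.
have hb0 : homogeneous 0 b0.
  rewrite /b0 -big_filter; apply: (subspace_sum (homogeneous_subspace 0)) => y.
  by rewrite mem_filter => /andP[/eqP y0 /Pr[_]]; rewrite y0.
have eb0 : e b0 = 1.
  rewrite -eb bE [in RHS](bigID (fun y => y.1 == 0)) /= rmorphD /= -/b0.
  rewrite [X in _ + X](_ : _ = 0) ?addr0 // rmorph_sum big_seq_cond big1 //.
  by move=> y /andP[/Pr[_ hy] y0]; exact: homogeneous_counit0 hy.
exists b0; split => //.
have [||z _ zE] := @nonpositive_combos 0 (1 - b0) (lexx 0).
- by move=> t; rewrite rmorphB rmorph1 /= hb0 !scale1r.
- by rewrite /aug /= rmorphB rmorph1 /= eb0 subrr.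
by rewrite zE mulr_sumr big1 // => i _; rewrite mulrCA Wb0 mulr0.
Qed.

(** A point at which J vanishes only sees the part of a in k + A_+, and a
    homogeneous element y contributes g y t^d with d > 0. *)
Lemma orbit_polynomial (g : {lrmorphism A -> k^o}) a :
  (forall i, g (x i) = 0) ->
  exists2 p : {poly k}, p.[0] = e a &
    forall t, g (delta t a) = p.[gm_val t].
Proof.
move=> gx; have [c [j [_ [J [r Pr ->] ->]]]] := A_almost_positive a.
have gJ b : combos setT b -> g b = 0.
  move=> [w _ ->]; rewrite rmorph_sum big1 // => i _.
  by rewrite rmorphM /= gx mulr0.
have g_in_alg z : g z%:A = z by rewrite linearZ /= rmorph1 [_ *: _]mulr1.
exists (c%:P + \sum_(y <- r) g y.2 *: 'X^`|y.1|%N).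
  rewrite !rmorphD /= counit_in_alg (combosT_counit J) addr0 hornerD hornerC.
  rewrite rmorph_sum horner_sum !big_seq !big1 // => y /Pr[y0 hy].
    by apply: homogeneous_counit0 hy; rewrite gt_eqF.
  by rewrite hornerZ hornerXn expr0n absz_eq0 gt_eqF // mulr0.
move=> t; rewrite !rmorphD /= linearZ /= rmorph1 g_in_alg.
rewrite (gJ (delta t j)) ?addr0; last by apply: combos_stable.
rewrite hornerD hornerC; congr (_ + _).
rewrite !rmorph_sum horner_sum big_seq [RHS]big_seq; apply: eq_bigr => y /Pr[y0 hy].
rewrite /= hy linearZ hornerZ hornerXn /= [_ *: _]mulrC; congr (_ * _).
by rewrite -[in LHS](gez0_abs (ltW y0)).
Qed.

End NonpositiveGenerators.

Lemma homogeneous_subr_counit d a :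
  homogeneous d a -> homogeneous d (a - (e a)%:A).
Proof.
move=> ha; have [d0|d0] := eqVneq d 0; last first.
  by rewrite (homogeneous_counit0 d0 ha) scale0r subr0.
by move=> t; rewrite rmorphB /= ha linearZ /= rmorph1 d0 !scale1r.
Qed.

(** The x_i are the components of nonpositive degree of generators of A,
    corrected by constants so as to lie in m. *)
Lemma nonpositive_generators (X : set A) : finite_set X -> generates X ->
  exists n (x : 'I_n -> A) (d : 'I_n -> int),
    [/\ forall i, homogeneous (d i) (x i), forall i, d i <= 0,
        forall i, aug (x i) & forall a, almost_positive x a].
Proof.
move=> /finite_seqP[s ->] gen_s.
have /choice[r rP] : forall a, exists r : seq (int * A),
    (forall y, y \in r -> homogeneous y.1 y.2) /\ a = \sum_(y <- r) y.2.
  by move=> a; have [r hr aE] := gradedT a; exists r; split => // y /hr[].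
pose L := [seq (y.1, y.2 - (e y.2)%:A) | y <- flatten (map r s) & y.1 <= 0].
have LP (i : 'I_(size L)) : let y := nth (0, 0) L i in
    [/\ homogeneous y.1 y.2, y.1 <= 0 & aug y.2].
  have /mapP[y] := mem_nth (0, 0) (ltn_ord i).
  rewrite mem_filter => /andP[y0 /flattenP[_ /mapP[a _ ->] yr]] -> /=.
  split => //; last exact: subr_counit.
  exact: homogeneous_subr_counit ((rP a).1 _ yr).
pose x i := (nth (0, 0) L (i : 'I_(size L))).2.
exists (size L), x, (fun i => (nth (0, 0) L i).1); split => [i|i|i|].
- by have [] := LP i.
- by have [] := LP i.
- by have [] := LP i.
have subS := almost_positive_subspace x.
have S0 : combos x setT 0 by exact: (combos_subspace _ (@subspaceT A)).1.
have P0 : positive_part 0 by exact: (graded_subspace _).1.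
move=> a; apply/asboolP; move: a.
apply: (gen_s (fun a => `[< almost_positive x a >])); first split.
- by apply/asboolP; exists 1, 0, 0; rewrite scale1r !addr0.
- by move=> c u v /asboolP Su /asboolP Sv; apply/asboolP; apply: subS.2.
- move=> u v /asboolP Su /asboolP Sv; apply/asboolP; exact: almost_positiveM.
move=> a /= as_; apply/asboolP; rewrite (rP a).2.
apply: subspace_sum => // y yr; have hy := (rP a).1 _ yr.
have [y0|y0] := leP y.1 0; last first.
  exists 0, 0, y.2; split; rewrite ?scale0r ?add0r //.
  exact: (@graded_homogeneous _ y.1).
have yL : (y.1, y.2 - (e y.2)%:A) \in L.
  apply/mapP; exists y => //; rewrite mem_filter y0; apply/flattenP.
  by exists (r a) => //; exact: map_f.
have iL := yL; rewrite -index_mem in iL.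
exists (e y.2), (x (Ordinal iL)), 0; split => //; first exact: combos_gen.
by rewrite /x /= nth_index //= addr0 addrC subrK.
Qed.

(** A functional that is 1 at a and vanishes on W, the span of the constants,
    of m^2 and of the components of m in degrees other than d. The first two
    make it a derivation at the identity, the last one a weight vector. *)
Lemma tangent_weight_vector d a :
  homogeneous d a -> aug a -> ~ aug2 a ->
  exists D : {linear A -> k^o},
    [/\ forall u v, D (u * v) = e u * D v + e v * D u, D a = 1
      & forall t u, D (delta t u) = gm_val t ^ d *: D u].
Proof.
move=> ha a0 a2; pose P := [set c : int | c <> d].
pose W := [set u | exists c q p,
  [/\ aug2 q, graded P p, aug p & u = c%:A + q + p]].
have subG := graded_subspace P.
have subW : subspace W.
  split=> [|c u v [c1 [j1 [p1 [J1 P1 A1 ->]]]] [c2 [j2 [p2 [J2 P2 A2 ->]]]]].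
    exists 0, 0, 0; split; rewrite ?scale0r ?addr0 //.
    - exact: aug2_subspace.1.
    - exact: subG.1.
    - exact: aug_subspace.1.
  exists (c * c1 + c2), (c *: j1 + j2), (c *: p1 + p2); split.
  - by apply: aug2_subspace.2.
  - by apply: subG.2.
  - by apply: aug_subspace.2.
  by rewrite !scalerDr scalerDl scalerA addrACA (addrACA _ (c *: j1)).
have Wa : ~ W a.
  move=> [c [q [p [Q G p0 aE]]]]; apply: a2.
  have q0 : e q = 0.
    have [s sP ->] := Q; rewrite rmorph_sum big_seq big1 // => y /sP[y1 _].
    by rewrite rmorphM /= y1 mul0r.
  have c0 : c = 0.
    by have := a0; rewrite aE /aug /= !rmorphD /= counit_in_alg q0 p0 !addr0.
  apply: (@graded_complement _ P d a (- p)) => //.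
  - exact: aug2_subspace.
  - exact: aug2_stable.
  - by rewrite -scaleN1r; apply: subspaceZ.
  by rewrite aE c0 scale0r add0r addrK.
have [D [DW Da]] := functional_outside subW Wa.
have W2 q : aug2 q -> W q.
  by move=> Q; exists 0, q, 0; rewrite scale0r add0r addr0; split;
    [|exact: subG.1|exact: aug_subspace.1|].
have D1 c : D c%:A = 0.
  apply: DW; exists c, 0, 0; rewrite !addr0; split => //.
  - exact: aug2_subspace.1.
  - exact: subG.1.
  - exact: aug_subspace.1.
exists D; split => // [u v|t u].
  have /DW := W2 _ (aug2M (subr_counit u) (subr_counit v)).
  have -> : (u - (e u)%:A) * (v - (e v)%:A) =
      u * v - e v *: u - e u *: v + (e u * e v)%:A.
    rewrite mulrBl !mulrBr -!scalerAl -!scalerAr mulr1 mul1r scalerA.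
    by rewrite mulr1 opprB addrA addrAC.
  rewrite linearD linearB /= linearB /= D1 addr0 => /eqP.
  by rewrite subr_eq0 subr_eq => /eqP ->; rewrite !linearZ.
have [r Pr ->] := gradedT u.
rewrite !linear_sum /= big_seq [RHS]big_seq; apply: eq_bigr.
move=> y /Pr[_ hy]; rewrite hy linearZ /=.
have [->//|/eqP yd] := eqVneq y.1 d.
suff -> : D y.2 = 0 by rewrite !scaler0.
apply: DW; exists (e y.2), 0, (y.2 - (e y.2)%:A); split.
- exact: aug2_subspace.1.
- exact: graded_homogeneous yd (homogeneous_subr_counit hy).
- exact: subr_counit.
by rewrite addr0 addrC subrK.
Qed.

End GradedAlgebra.
(** * The grading of the coordinate ring *)

HB.instance Definition _ (R : comNzRingType) := gen_eqMixin (gm R).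
HB.instance Definition _ (R : comNzRingType) := gen_choiceMixin (gm R).
HB.instance Definition _ (R : comNzRingType) := isPointed.Build (gm R) (gm1 R).

Section LaurentAlgebra.
Variables (k : fieldType) (A : comAlgType k).

(** When k is infinite, a Laurent polynomial over A is determined by its values
    at the points of k^*. Realizing the Laurent polynomials as functions makes
    their ring structure pointwise. *)
Definition gm_function := gm k -> A.
HB.instance Definition _ := GRing.ComNzRing.on gm_function.
HB.instance Definition _ := GRing.Lmodule.on gm_function.

Fact gm_function_scaleAl (c : k) (f g : gm_function) : c *: (f * g) = c *: f * g.
Proof. by apply/funext => t; exact: scalerAl. Qed.
HB.instance Definition _ :=
  GRing.Lmodule_isLalgebra.Build k gm_function gm_function_scaleAl.

Fact gm_function_scaleAr (c : k) (f g : gm_function) : c *: (f * g) = f * (c *: g).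
Proof. by apply/funext => t; exact: scalerAr. Qed.
HB.instance Definition _ :=
  GRing.Lalgebra_isAlgebra.Build k gm_function gm_function_scaleAr.

Definition is_laurent : {pred gm_function} := fun f =>
  `[< exists r : seq (int * A),
      forall t, f t = \sum_(x <- r) gm_val t ^ x.1 *: x.2 >].

Fact is_laurent_subalg : GRing.subalg_closed is_laurent.
Proof.
split=> [|c f g /asboolP[r fr] /asboolP[s gs]|f g /asboolP[r fr] /asboolP[s gs]].
- by apply/asboolP; exists [:: (0, 1)] => t; rewrite big_seq1 scale1r.
- apply/asboolP; exists ([seq (x.1, c *: x.2) | x <- r] ++ s) => t.
  rewrite big_cat big_map /= -gs [LHS]/(c *: f t + g t) fr scaler_sumr.
  by congr (_ + _); apply: eq_bigr => x _; rewrite !scalerA mulrC.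
apply/asboolP; exists [seq (x.1 + y.1, x.2 * y.2) | x <- r, y <- s] => t.
transitivity ((f t : A) * (g t : A)); first by [].
rewrite big_allpairs_dep fr gs mulr_suml.
apply: eq_bigr => x _; rewrite mulr_sumr; apply: eq_bigr => y _ /=.
by rewrite -scalerAl -scalerAr scalerA expfzDr ?gm_val_neq0.
Qed.
HB.instance Definition _ :=
  GRing.isSubalgClosed.Build k gm_function is_laurent is_laurent_subalg.

Record laurent := Laurent {
  laurent_fun : gm_function;
  laurentP : laurent_fun \in is_laurent
}.
HB.instance Definition _ := [isSub for laurent_fun].
HB.instance Definition _ := [Choice of laurent by <:].
HB.instance Definition _ := [SubChoice_isSubComNzRing of laurent by <:].
HB.instance Definition _ := [SubZmodule_isSubLmodule of laurent by <:].
HB.instance Definition _ := [SubNzRing_SubLmodule_isSubLalgebra of laurent by <:].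
HB.instance Definition _ := [SubLalgebra_isSubAlgebra of laurent by <:].

Definition laurent_eval (t : gm k) (f : laurent) : A := laurent_fun f t.

Fact laurent_eval_linear t : linear (laurent_eval t).
Proof. by []. Qed.
HB.instance Definition _ t :=
  GRing.isLinear.Build k laurent A _ (laurent_eval t) (laurent_eval_linear t).

Fact laurent_eval_monoid t : monoid_morphism (laurent_eval t).
Proof. by []. Qed.
HB.instance Definition _ t :=
  GRing.isMonoidMorphism.Build laurent A (laurent_eval t) (laurent_eval_monoid t).

Fact laurent_const_subproof a : (fun=> a : A) \in is_laurent.
Proof. by apply/asboolP; exists [:: (0, a)] => t; rewrite big_seq1 scale1r. Qed.

Definition laurent_const a : laurent := Laurent (laurent_const_subproof a).

Fact laurent_const_linear : linear laurent_const.
Proof. by move=> c a b; apply: val_inj. Qed.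
HB.instance Definition _ :=
  GRing.isLinear.Build k A laurent _ laurent_const laurent_const_linear.

Fact laurent_const_monoid : monoid_morphism laurent_const.
Proof. by split=> [|a b]; apply: val_inj. Qed.
HB.instance Definition _ :=
  GRing.isMonoidMorphism.Build A laurent laurent_const laurent_const_monoid.

Fact laurent_X_subproof : (fun t : gm k => (gm_val t)%:A : A) \in is_laurent.
Proof. by apply/asboolP; exists [:: (1, 1)] => t; rewrite big_seq1 expr1z. Qed.

Fact laurent_Xinv_subproof : (fun t : gm k => (gm_inv t)%:A : A) \in is_laurent.
Proof.
apply/asboolP; exists [:: (- 1, 1)] => t; rewrite big_seq1 exprN1.
by rewrite -[gm_inv t](mulKf (gm_val_neq0 t)) gm_valV mulr1.
Qed.

Fact laurent_X_inverse :
  Laurent laurent_X_subproof * Laurent laurent_Xinv_subproof = 1.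
Proof.
apply: val_inj; apply/funext => t /=.
transitivity ((gm_val t)%:A * (gm_inv t)%:A : A); first by [].
by rewrite -scalerAl mul1r scalerA gm_valV scale1r.
Qed.

Definition laurent_X : gm laurent := Gm laurent_X_inverse.

End LaurentAlgebra.

Section SchemeAction.
Variables (k : fieldType) (U : groupScheme k) (alpha : gmAction U).
Local Notation A := (Defs.coord U).
Local Notation delta := (comorphism alpha).

Lemma lrmorphism_ext (R S : comAlgType k) (f g : {lrmorphism R -> S}) :
  f =1 g -> f = g.
Proof.
case: f g => [f cf] [g cg] /= /funext fg; subst g; congr GRing.LRMorphism.Pack.
case: cf cg => [[a1] [b1] [c1]] [[a2] [b2] [c2]].
by rewrite (Prop_irrelevance a1 a2) (Prop_irrelevance b1 b2) (Prop_irrelevance c1 c2).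
Qed.

Lemma gm_ext (R : comNzRingType) (s t : gm R) : gm_val s = gm_val t -> s = t.
Proof.
case: s t => [a a' aa'] [b b' bb'] /= ab; subst b.
have a'b' : a' = b' by rewrite -[a']mulr1 -bb' mulrCA mulrA aa' mul1r.
by subst b'; congr Gm; exact: Prop_irrelevance.
Qed.

Definition tautological : points U A := idfun : {lrmorphism A -> A}.

Lemma pt_map_tautological (R : comAlgType k) (g : points U R) :
  pt_map (pt_fun g) tautological = g.
Proof. exact: lrmorphism_ext. Qed.

(** Yoneda: g is the image of the tautological point under g itself. *)
Lemma gma_act_comorphism (R : comAlgType k) (t : gm k) (g : points U R) a :
  pt_fun (gma_act alpha (gm_map (GRing.in_alg R) t) g) a
  = pt_fun g (delta t a).
Proof.
have -> : gm_map (GRing.in_alg R) t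
    = gm_map (pt_fun g) (gm_map (GRing.in_alg A) t).
  by apply: gm_ext; rewrite /= linearZ /= rmorph1.
by rewrite -{2}(pt_map_tautological g) gma_nat.
Qed.

Lemma act_pt_comorphism (t : gm k) (g : points U k^o) a :
  pt_fun (act_pt alpha t g) a = pt_fun g (delta t a).
Proof.
rewrite -gma_act_comorphism; congr (pt_fun (gma_act alpha _ g) a).
by apply: gm_ext; rewrite /= [_ *: _]mulr1.
Qed.

Lemma comorphism1 a : delta (gm1 k) a = a.
Proof.
rewrite /comorphism; have -> : gm_map (GRing.in_alg A) (gm1 k) = gm1 A.
  by apply: gm_ext; rewrite /= scale1r.
by rewrite gma_act1.
Qed.

Lemma comorphismM s t a : delta (gm_mul s t) a = delta t (delta s a).
Proof.
rewrite -(gma_act_comorphism s (delta t : points U A)) {1}/comorphism.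
have -> : gm_map (GRing.in_alg A) (gm_mul s t)
    = gm_mul (gm_map (GRing.in_alg A) s) (gm_map (GRing.in_alg A) t).
  by apply: gm_ext; rewrite /= -scalerAl mul1r scalerA.
by rewrite gma_actM.
Qed.

(** The coaction, obtained by letting the variable T in k[T, T^-1] act on the
    tautological point, with values in A[T, T^-1]; specializing T to t recovers
    delta t. *)
Lemma comorphism_laurent a : exists r : seq (int * A),
  forall t, delta t a = \sum_(x <- r) gm_val t ^ x.1 *: x.2.
Proof.
pose c : points U (laurent A) := @laurent_const k A : {lrmorphism A -> laurent A}.
have /asboolP[r fr] := laurentP (pt_fun (gma_act alpha (laurent_X A) c) a).
exists r => t; rewrite -fr /comorphism.
have -> : gm_map (GRing.in_alg A) t = gm_map (@laurent_eval k A t) (laurent_X A).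
  exact: gm_ext.
have {1}-> : (idfun : {lrmorphism A -> A}) = pt_map (@laurent_eval k A t) c.
  exact: lrmorphism_ext.
by rewrite gma_nat.
Qed.

Lemma act_pt1 t : act_pt alpha t 1%g = 1%g.
Proof. by apply: (mulgI (act_pt alpha t 1%g)); rewrite -gma_mul !mulg1. Qed.

Lemma unit_comorphism t a :
  pt_fun (1%g : points U k^o) (delta t a) = pt_fun (1%g : points U k^o) a.
Proof. by rewrite -act_pt_comorphism act_pt1. Qed.

End SchemeAction.
(** * Orbits of rational points under a positive action *)

Section Kernel.
Variables (k : fieldType) (A : comAlgType k) (g : {lrmorphism A -> k^o}).

Definition kernel : {pred A} := fun a => g a == 0.

Fact kernel_idealr : idealr_closed kernel.
Proof.
split; rewrite /kernel ?unfold_in ?rmorph0 ?rmorph1 ?oner_eq0 //.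
move=> a u v; rewrite !unfold_in => /eqP u0 /eqP v0.
by rewrite rmorphD rmorphM /= u0 v0 mulr0 addr0.
Qed.
HB.instance Definition _ := isIdealr.Build A kernel kernel_idealr.

Fact kernel_prime : prime_idealr_closed kernel.
Proof. by move=> u v; rewrite !unfold_in rmorphM /= mulf_eq0. Qed.
HB.instance Definition _ := isPrimeIdealrClosed.Build A kernel kernel_prime.
End Kernel.

(** The loci of b and of 1 - b partition Spec A, and the point g is not in the
    first one, which therefore contains no point at all. *)
Lemma connected_idempotent (k : fieldType) (U : groupScheme k) (g h : points U k^o)
    (b : Defs.coord U) :
  connected U -> b * (1 - b) = 0 -> pt_fun g b = 1 -> pt_fun h b != 0.
Proof.
move=> connU bb gb; apply/eqP => hb.
have [||V0|V0] := connU [set b] [set 1 - b].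
- apply/seteqP; split => // P _; have := rpred0 P; rewrite -bb prime_idealrM.
  by move=> /orP[Pb|Pb]; [left|right] => _ ->.
- apply/seteqP; split => // P [Pb Pb'].
  have : 1 - b + b \in (P : prime_idealr _).
    by apply: rpredD; [exact: Pb'|exact: Pb].
  by rewrite subrK idealr1.
- have : zero_locus [set b] (kernel (pt_fun h) : Spec _).
    by move=> _ ->; rewrite unfold_in hb.
  by rewrite V0.
have : zero_locus [set 1 - b] (kernel (pt_fun g) : Spec _).
  by move=> _ ->; rewrite unfold_in rmorphB /= rmorph1 gb subrr.
by rewrite V0.
Qed.

Section PositiveActions.
Variables (k : fieldType) (U : groupScheme k) (alpha : gmAction U).
Hypothesis k_infinite : infinite_set [set: k].
Local Notation A := (Defs.coord U).
Local Notation e := (pt_fun (1%g : points U k^o)).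

Lemma positive_nonpositive_aug2 : positive alpha ->
  forall c a, c <= 0 -> homogeneous (comorphism alpha) c a ->
  aug e a -> aug2 e a.
Proof.
move=> pos c a c0 ha a0; apply: contrapT => a2.
have [D [DM Da DW]] := tangent_weight_vector k_infinite (comorphism1 alpha)
  (comorphismM alpha) (comorphism_laurent alpha) (unit_comorphism alpha) ha a0 a2.
have /pos : weight alpha c.
  exists D; split => //; first by exists a; rewrite Da oner_eq0.
by rewrite ltNge c0.
Qed.

(** At every rational point g the idempotent b is nonzero, so g kills the
    generators of J. *)
Lemma orbit_polynomial_map : smooth U -> connected U -> positive alpha ->
  forall (g : points U k^o) a, exists2 p : {poly k}, p.[0] = e a &
    forall t, pt_fun (act_pt alpha t g) a = p.[gm_val t].
Proof.
move=> [[X finX genX] _] connU pos g a.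
have aug2P := positive_nonpositive_aug2 pos.
have [n [x [d [hx d0 x0 Ax]]]] := nonpositive_generators k_infinite
  (comorphism1 alpha) (comorphismM alpha) (comorphism_laurent alpha)
  (unit_comorphism alpha) finX genX.
have [b [eb bx bb]] := idempotent_annihilator k_infinite
  (comorphism1 alpha) (comorphismM alpha) (comorphism_laurent alpha)
  (unit_comorphism alpha) hx d0 x0 Ax aug2P.
have gx i : pt_fun g (x i) = 0.
  have /eqP : pt_fun g (b * x i) = 0 by rewrite bx rmorph0.
  rewrite rmorphM mulf_eq0 (negPf (connected_idempotent g connU bb eb)).
  by move=> /eqP.
have [p p0 pt] := orbit_polynomial k_infinite
  (unit_comorphism alpha) hx x0 Ax a gx.
by exists p => // t; rewrite act_pt_comorphism pt.
Qed.

End PositiveActions.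
(** * Group rings of rational points *)

Section UnipotentPoints.
Variables (k : fieldType) (U : groupScheme k) (n : nat) (M : 'M[Defs.coord U]_n).
Hypothesis M_unitri : forall i j : 'I_n, (j <= i)%N -> M i j = (i == j)%:R.
Hypothesis M_generates : generates [set a | exists i j, a = M i j].

Definition point_matrix (g : points U k^o) : 'M[k]_n := map_mx (pt_fun g) M.

Lemma point_matrix_unitri g (i j : 'I_n) :
  (j <= i)%N -> point_matrix g i j = (i == j)%:R.
Proof. by move=> ji; rewrite mxE M_unitri // rmorph_nat. Qed.

Lemma point_matrix_inj : injective point_matrix.
Proof.
move=> g h /matrixP gh; apply: lrmorphism_ext.
pose S : {pred Defs.coord U} := fun a => pt_fun g a == pt_fun h a.
suff inS a : a \in S by move=> a; apply/eqP/inS.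
apply: M_generates.
  split=> [|c u v /eqP gu /eqP gv|u v /eqP gu /eqP gv]; apply/eqP.
  - by rewrite !rmorph1.
  - by rewrite !linearP /= gu gv.
  - by rewrite !rmorphM /= gu gv.
by move=> _ [i [j ->]]; apply/eqP; have := gh i j; rewrite !mxE.
Qed.

Variable alpha : gmAction U.

(** The value 1 at t = 0 is the one that extends the orbit to a polynomial
    map. *)
Definition orbit_map (g : points U k^o) (t : k) : points U k^o :=
  if pselect (t != 0) is left t0 then act_pt alpha (gm_unit t0) g else 1%g.

Lemma orbit_map0 g : orbit_map g 0 = 1%g.
Proof.
by rewrite /orbit_map; case: pselect => // t0; exfalso; rewrite eqxx in t0.
Qed.

Lemma orbit_map_unit g t (t0 : t != 0) :
  orbit_map g t = act_pt alpha (gm_unit t0) g.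
Proof.
rewrite /orbit_map; case: pselect => // t0'.
by rewrite (bool_irrelevance t0 t0').
Qed.

Lemma polynomial_orbit_map g : infinite_set [set: k] -> smooth U ->
  connected U -> positive alpha -> polynomial_map point_matrix (orbit_map g).
Proof.
move=> kinf smU connU pos.
have /choice[p pP] : forall ij : 'I_n * 'I_n, exists p : {poly k},
    p.[0] = pt_fun (1%g : points U k^o) (M ij.1 ij.2) /\
    forall t, pt_fun (act_pt alpha t g) (M ij.1 ij.2) = p.[gm_val t].
  move=> [i j]; have [p p0 pt] := orbit_polynomial_map kinf smU connU pos g (M i j).
  by exists p.
exists (\matrix_(i, j) p (i, j)) => t i j; rewrite !mxE.
have [p0 pt] := pP (i, j); have [->|t0] := eqVneq t 0.
  by rewrite orbit_map0 p0.
by rewrite (orbit_map_unit g t0) pt.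
Qed.

End UnipotentPoints.

Theorem theorem2 (k : fieldType) (k_infinite : infinite_set [set: k])
    (U : groupScheme k) (U_smooth : smooth U) (U_connected : connected U)
    (U_unipotent : unipotent U)
    (alpha : gmAction U) (alpha_positive : positive alpha)
    (F : fieldType) (I : set (groupRing F (points U k^o)))
    (I_left_ideal : left_ideal I)
    (I_stable : gm_stable alpha I)
    (I_not_augmentation :
      ~ (I `<=` augmentation_ideal (F := F) (G := points U k^o))) :
  I = [set: groupRing F (points U k^o)].
Proof.
have [n [M [M_unitri M_mul M_gen]]] := U_unipotent.
have [x Ix augx] : exists2 x, I x & augmentation x != 0.
  apply: contrapT => noI; apply: I_not_augmentation => x Ix.
  by apply/eqP; apply: contrapT => /negP augx; apply: noI; exists x.
pose l := [seq (x@_g, orbit_map alpha g) | g <- msupp x].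
have l_poly y : y \in l -> polynomial_map (point_matrix M) y.2.
  by move=> /mapP[g _ ->]; exact: polynomial_orbit_map.
have Il t : t != 0 -> I (expansion l t).
  move=> t0; have := I_stable (gm_unit t0) x Ix; congr (I _).
  rewrite /gr_map /expansion big_map; apply: eq_bigr => g _.
  by rewrite /= orbit_map_unit.
have := value_at0_polynomial (M_mul k^o) (point_matrix_unitri M_unitri)
  (point_matrix_inj M_gen) k_infinite I_left_ideal l_poly Il.
have -> : expansion l 0 = group_elt (augmentation x) 1%g.
  rewrite /expansion big_map /augmentation /group_elt raddf_sum.
  by apply: eq_bigr => g _; rewrite /= orbit_map0.
move=> Iaug; apply/seteqP; split => // y _.
have [_ _ IM] := I_left_ideal.
have -> : y = (y * group_elt (augmentation x)^-1 1%g)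
    * group_elt (augmentation x) 1%g.
  by rewrite -mulrA group_eltM mulVf // mulg1 mulr1.
exact: IM.
Qed.
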